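(* Fix $q\in[0,1]$ and rate functions $\{r(z,u)\}_{z\in\mathbb Z,u\ge0}$ with $0\le r(z,u)\le C$ for a constant $C$ and $u\mapsto r(z,u)$ piecewise continuous for each $z$. Consider the three-color ASEP (colors $1<2<+\infty$) with rates $r(z,u)$ and initial configuration $\eta_0(z)=1$ for $z<0$, $\eta_0(0)=2$, $\eta_0(z)=+\infty$ for $z>0$, and let $\mathfrak f_2(u)$ be the position at time $u$ of its unique particle of color 2. Fix $\tau\ge 0$ and $x\in\mathbb R$, and consider the two-color ASEP (colors $1<+\infty$) with initial configuration $\hat\eta_0(z)=1$ for $z\le x$, $\hat\eta_0(z)=+\infty$ for $z>x$, and time-reversed rates $\hat r(z,u):=r(z,\tau-u)$, $0\le u\le\tau$; let $\mathfrak p_1^x(\tau)$ be the probability that in this process site $0$ is occupied by a particle of color $1$ at time $\tau$. Then $$\mathrm{Prob}(\mathfrak f_2(\tau)\le x)=\mathfrak p_1^x(\tau).$$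
   Context: A configuration is a map $\eta:\mathbb Z\to\mathbb Z\cup\{+\infty\}$ giving the color of the particle at each site (color $+\infty$ represents a hole). For $x'\in[0,1]$ the random asymmetric swap $W_{(z,z+1),x'}$ exchanges the values $\eta(z),\eta(z+1)$ with probability $x'$ if $\eta(z)<\eta(z+1)$, with probability $qx'$ if $\eta(z)>\eta(z+1)$, and otherwise leaves $\eta$ unchanged. The (inhomogeneous) colored ASEP with rates $r(z,u)$: independent Poisson processes $\mathcal P(z)$, $z\in\mathbb Z$, with intensity $r(z,u)$ at time $u$; at each point of $\mathcal P(z)$ the swap $W_{(z,z+1),1}$ is applied to the current configuration. Thus a particle of lower color exchanges with a higher color on its right at rate $r(z,u)$ and with a higher color on its left at rate $q\,r(z,u)$. *)

(* Defs.v *)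
From HB Require Import structures.
From mathcomp Require Import all_boot all_order all_algebra.
From mathcomp Require Import all_classical all_reals all_analysis.
Set Implicit Arguments. Unset Strict Implicit. Unset Printing Implicit Defensive.
Import Order.TTheory GRing.Theory Num.Theory numFieldNormedType.Exports.
Local Open Scope classical_set_scope.
Local Open Scope ring_scope.

(* Colors: [Some c] is color c : int, [None] is the hole (color +oo). *)
Definition color := option int.
Definition config := int -> color.

Definition col_lt (a b : color) : bool :=
  match a, b with
  | Some a, Some b => a < b
  | Some _, None => true
  | None, _ => false
  end.

Definition swap_at (z : int) (eta : config) : config :=
  fun y => if y == z then eta (z + 1) else if y == z + 1 then eta z else eta y.

(* Random asymmetric swap W_{(z,z+1),1}, with the auxiliary randomness
   supplied by a coin [c] (c = true with probability q): swap with
   probability 1 if eta z < eta (z+1), with probability q if eta z > eta (z+1). *)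
Definition W_step (c : bool) (z : int) (eta : config) : config :=
  if col_lt (eta z) (eta (z + 1)) || (col_lt (eta (z + 1)) (eta z) && c)
  then swap_at z eta else eta.

Section Defs.
Variable R : realType.

Definition piecewise_continuous (f : R -> R) : Prop :=
  forall Tm : R, exists D : seq R,
    forall u : R, 0 < u < Tm -> u \notin D -> {for u, continuous f}.

Definition Lam (r : int -> R -> R) (z : int) (t : R) : R :=
  Rintegral (@lebesgue_measure R) `[0, t] (r z).

(* partial sums E_{z,0} + ... + E_{z,k} of the unit exponential variables;
   the k-th point (k >= 0) of the Poisson process P(z) with intensity r(z,.)
   is the time T at which Lam r z T reaches Sk E z k (time change of a rate-1
   Poisson process). *)
Definition Sk (E : int -> nat -> R) (z : int) (k : nat) : R :=
  \sum_(i < k.+1) E z i.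

Definition before (r : int -> R -> R) (E : int -> nat -> R)
    (p p' : int * nat) : Prop :=
  exists t : R, 0 <= t /\ Sk E p.1 p.2 <= Lam r p.1 t /\
                Lam r p'.1 t < Sk E p'.1 p'.2.

Definition listing (r : int -> R -> R) (E : int -> nat -> R) (M : nat) (t : R)
    (s : seq (int * nat)) : Prop :=
  uniq s /\
  (forall p : int * nat, p \in s <-> ((`|p.1| <= M%:Z)%R /\ Sk E p.1 p.2 <= Lam r p.1 t)) /\
  sorted (fun a b => `[< before r E a b >]) s.

Definition run (q : R) (U : int -> nat -> R) (eta0 : config)
    (s : seq (int * nat)) : config :=
  foldl (fun eta p => W_step (U p.1 p.2 < q) p.1 eta) eta0 s.

(* "the configuration of the ASEP at time t satisfies Q": computed with the
   system restricted to bonds |z| <= M, for all sufficiently large M (the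
   initial data below only have finitely many active bonds, so this is the
   usual graphical construction). *)
Definition asep_event (r : int -> R -> R) (q : R) (eta0 : config) (t : R)
    (E U : int -> nat -> R) (Q : config -> Prop) : Prop :=
  exists M0 : nat, forall M : nat, (M0 <= M)%N ->
    exists s, listing r E M t s /\ Q (run q U eta0 s).

Definition mutually_independent d (T : measurableType d) (P : probability T R)
    (I : eqType) (X : I -> T -> R) : Prop :=
  (forall i, measurable_fun setT (X i)) /\
  forall (J : seq I) (B : I -> set R), uniq J -> (forall j, measurable (B j)) ->
    P (\bigcap_(j in [set` J]) (X j @^-1` B j)) =
    \big[*%E/1%E]_(j <- J) P (X j @^-1` B j).

Definition clock_family d (T : measurableType d) (P : probability T R)
    (X : int * nat * bool -> T -> R) : Prop :=
  mutually_independent P X /\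
  (forall z k (s : R), P [set w | X (z, k, false) w <= s] =
       (if 0 <= s then 1 - expR (- s) else 0)%:E) /\
  (forall z k (s : R), P [set w | X (z, k, true) w <= s] =
       (Num.min (Num.max s 0) 1)%:E).

Definition Efam d (T : measurableType d) (X : int * nat * bool -> T -> R)
  (w : T) : int -> nat -> R := fun z k => X (z, k, false) w.
Definition Ufam d (T : measurableType d) (X : int * nat * bool -> T -> R)
  (w : T) : int -> nat -> R := fun z k => X (z, k, true) w.

Definition eta0_three : config :=
  fun z => if z < 0 then Some 1 else if z == 0 then Some 2 else None.
Definition eta0_two (x : R) : config :=
  fun z => if (z%:~R <= x) then Some 1 else None.

(* time-reversed rates (values for u > tau are irrelevant) *)
Definition rhat (r : int -> R -> R) (tau : R) : int -> R -> R :=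
  fun z u => if u <= tau then r z (tau - u) else 0.

End Defs.

(* Main.v *)
(* Two ideas. (1) Algebra: on bijections of the integers, the averaged swaps of
   positions z, z+1 commute with the averaged swaps of values w, w+1 (left and
   right multiplication in the Hecke algebra), and both agree on the identity;
   hence applying a word of bonds to the identity gives the inverse, in law, of
   applying the reversed word. The two initial data are monotone images of the
   identity colouring, and inversion turns "the position of color 2 is <= x"
   into "the color at 0 is <= x".
   (2) Reversal of the clocks: cut [0, tau] into N slots. The probability that
   the bonds |z| <= M ring at most once per slot, in a prescribed pattern, is
   exp(-total) times the product of the increments of [Lam] over the occupied
   slots, which is symmetric under time reversal; the patterns exhaust the
   probability as N -> oo. Finally M -> oo: with probability exponentially close
   to 1 some bond on either side of the origin within distance n never rings, and
   then nothing beyond these two bonds matters. *)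
Require Import Defs.
From HB Require Import structures.
From mathcomp Require Import all_boot all_order all_algebra.
From mathcomp Require Import all_classical all_reals all_analysis.
From mathcomp Require Import measurable_realfun ring lra zify.
Set Implicit Arguments. Unset Strict Implicit. Unset Printing Implicit Defensive.
Import Order.TTheory GRing.Theory Num.Theory numFieldNormedType.Exports.
Local Open Scope classical_set_scope.
Local Open Scope ring_scope.

(** * Hecke algebra symmetry *)

Definition tr (z y : int) : int :=
  if y == z then z + 1 else if y == z + 1 then z else y.

Lemma trK (z : int) : involutive (tr z).
Proof.
move=> y; rewrite /tr; case: (y =P z) => [->|yz].
  by case: (z + 1 =P z) => [|_]; [lia|rewrite eqxx].
by case: (y =P z + 1) => [->|yz1]; [rewrite eqxx|rewrite !(introF eqP)].
Qed.

Lemma tr_lt w a b : a != b ->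
  ~~ ((a == w) && (b == w + 1) || (a == w + 1) && (b == w)) ->
  (tr w a < tr w b) = (a < b).
Proof.
rewrite /tr => ab m.
case: (a =P w) => aw; case: (b =P w) => bw;
  case: (a =P w + 1) => aw1; case: (b =P w + 1) => bw1; lia.
Qed.

Definition state : Type := (int -> int) * (int -> int).

Definition flip (st : state) : state := (st.2, st.1).

Definition valid (st : state) : Prop := cancel st.1 st.2 /\ cancel st.2 st.1.

Definition swaps (c : bool) (a b : int) : bool := (a < b) || (c && (b < a)).

Definition rstep (c : bool) (z : int) (st : state) : state :=
  if swaps c (st.1 z) (st.1 (z + 1))
  then (fun y => st.1 (tr z y), fun y => tr z (st.2 y)) else st.

Definition lstep (c : bool) (z : int) (st : state) : state :=
  flip (rstep c z (flip st)).

Lemma valid_flip st : valid st -> valid (flip st).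
Proof. by case. Qed.

Lemma valid_rstep c z st : valid st -> valid (rstep c z st).
Proof.
case=> h1 h2; rewrite /rstep; case: ifP => // _.
by split=> y /=; rewrite ?h1 ?trK ?h2.
Qed.

Lemma swaps_tr c w a b : a != b ->
  ~~ ((a == w) && (b == w + 1) || (a == w + 1) && (b == w)) ->
  swaps c (tr w a) (tr w b) = swaps c a b.
Proof.
move=> ab m; rewrite /swaps !tr_lt //; first by rewrite eq_sym.
by rewrite orbC andbC (andbC (b == w)).
Qed.

Definition matched z w (st : state) : bool :=
  (st.1 z == w) && (st.1 (z + 1) == w + 1)
  || (st.1 z == w + 1) && (st.1 (z + 1) == w).

(* If positions [z], [z + 1] carry exactly the values [w], [w + 1], both steps
   are the same map; otherwise neither affects the comparison on which the
   other depends. *)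
Lemma matched_step c z w st : valid st -> matched z w st ->
  lstep c w st = rstep c z st /\ matched z w (rstep c z st).
Proof.
case: st => p r [/= h1 h2] m.
have m' : [/\ p z = w, p (z + 1) = w + 1, r w = z & r (w + 1) = z + 1] \/
          [/\ p z = w + 1, p (z + 1) = w, r w = z + 1 & r (w + 1) = z].
  move: m => /orP[/andP[/eqP e1 /eqP e2]|/andP[/eqP e1 /eqP e2]]; [left|right];
    by move: (h1 z) (h1 (z + 1)); rewrite /= in e1 e2; rewrite e1 e2.
have sE : swaps c (r w) (r (w + 1)) = swaps c (p z) (p (z + 1)).
  rewrite /swaps; by case: m' => -[-> -> -> ->]; case: c; lia.
have tE y : tr w (p y) = p (tr z y).
  have i1 : p y = w <-> y = r w by split=> [<-|->]; rewrite ?h1 ?h2.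
  have i2 : p y = w + 1 <-> y = r (w + 1) by split=> [<-|->]; rewrite ?h1 ?h2.
  rewrite /tr; case: (y =P z) => [->|yz]; last case: (y =P z + 1) => [->|yz1].
  - by case: m' => -[-> -> _ _]; rewrite eqxx //; case: (w + 1 =P w) => //; lia.
  - by case: m' => -[-> -> _ _]; rewrite eqxx //; case: (w + 1 =P w) => //; lia.
  - case: (p y =P w) => [/i1 e|_]; first by case: m' => -[_ _ e1 _]; congruence.
    by case: (p y =P w + 1) => [/i2 e|//]; case: m' => -[_ _ _ e1]; congruence.
have tE' y : r (tr w y) = tr z (r y).
  by apply: (can_inj h1); rewrite -tE !h2.
rewrite /lstep /rstep /flip /= sE; case: ifP => // _; split.
  have -> : (fun y => tr w (p y)) = (fun y => p (tr z y)) by apply/funext.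
  by have -> : (fun y => r (tr w y)) = (fun y => tr z (r y)) by apply/funext.
rewrite /matched /= /tr eqxx.
have -> : (z + 1 == z) = false by lia.
by rewrite eqxx orbC (andbC (p (z + 1) == w)) (andbC (p (z + 1) == w + 1)).
Qed.

Lemma unmatched_step c c' z w st : valid st -> ~~ matched z w st ->
  rstep c z (lstep c' w st) = lstep c' w (rstep c z st).
Proof.
case: st => p r [/= h1 h2] m.
have m' : ~~ ((r w == z) && (r (w + 1) == z + 1) || (r w == z + 1) && (r (w + 1) == z)).
  apply: contra m; rewrite /matched /=.
  by move=> /orP[/andP[/eqP <- /eqP <-]|/andP[/eqP <- /eqP <-]];
     rewrite !h2 !eqxx ?orbT.
have n1 : p z != p (z + 1) by rewrite (inj_eq (can_inj h1)); lia.
have n2 : r w != r (w + 1) by rewrite (inj_eq (can_inj h2)); lia.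
have s1 := swaps_tr c n1 m; have s2 := swaps_tr c' n2 m'.
rewrite /lstep /rstep /flip /=.
case e1: (swaps c (p z)) => /=; case e2: (swaps c' (r w)) => /=;
  by rewrite ?s1 ?s2 ?e1 ?e2.
Qed.

Section Averaging.
Variables (R : realType) (q : R).

Definition avg (step : bool -> int -> state -> state) (z : int)
    (f : state -> R) (st : state) : R :=
  q * f (step true z st) + (1 - q) * f (step false z st).

Lemma avgC z w f st : valid st ->
  avg rstep z (avg lstep w f) st = avg lstep w (avg rstep z f) st.
Proof.
move=> vst; rewrite /avg; have [m|m] := boolP (matched z w st).
  have h c c' : lstep c' w (rstep c z st) = rstep c' z (lstep c w st).
    have [e m2] := matched_step c vst m.
    by rewrite e; have [] := matched_step c' (valid_rstep c z vst) m2.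
  by rewrite !h.
by rewrite !unmatched_step //; ring.
Qed.

Lemma foldr_avgC ws w f st : valid st ->
  foldr (avg rstep) (avg lstep w f) ws st =
  avg lstep w (foldr (avg rstep) f ws) st.
Proof.
elim: ws st => //= y ws IH st vst.
by rewrite -avgC // /avg !IH //; exact: valid_rstep.
Qed.

Definition id_state : state := (id, id).

Lemma valid_id : valid id_state. Proof. by []. Qed.

(* The anti-involution [T_w -> T_(w^-1)] of the Hecke algebra. *)
Lemma foldr_avg_rev ws f :
  foldr (avg rstep) f ws id_state = foldr (avg lstep) f (rev ws) id_state.
Proof.
elim: ws f => //= z ws IH f.
rewrite rev_cons foldr_rcons -IH foldr_avgC; last exact: valid_id.
by rewrite /avg /lstep /rstep /flip /swaps /= ltrDl ltr01.
Qed.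

Lemma foldr_avg_flip ws f st :
  foldr (avg lstep) f ws st =
  foldr (avg rstep) (fun st => f (flip st)) ws (flip st).
Proof.
elim: ws st => [|z ws IH] st /=; first by case: st.
by rewrite /avg !IH /lstep /flip /=; case: (rstep _ _ _); case: (rstep _ _ _).
Qed.

Fixpoint coin_avg (Q : config -> Prop) (eta : config) (ws : seq int) : R :=
  if ws is z :: ws' then
    q * coin_avg Q (W_step true z eta) ws' +
    (1 - q) * coin_avg Q (W_step false z eta) ws'
  else (`[< Q eta >])%:R.

Definition mono_color (g : config) : Prop :=
  forall a b : int, a < b -> col_lt (g a) (g b) \/ g a = g b.

Lemma col_lt_irr a : col_lt a a = false.
Proof. by case: a => //= a; rewrite ltxx. Qed.

Lemma col_lt_asym a b : col_lt a b -> col_lt b a = false.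
Proof. by case: a b => [a|] [b|] //=; lia. Qed.

Lemma W_step_color (g : config) c z (p r : int -> int) : mono_color g ->
  p z != p (z + 1) ->
  W_step c z (g \o p) = g \o (rstep c z (p, r)).1.
Proof.
move=> mg; rewrite /W_step /rstep /swaps /= neq_lt => /orP[] h;
  rewrite ?h (lt_gtF h) /= ?andbT ?andbF ?orbF.
- have [l|e] := mg _ _ h.
    by rewrite l /=; apply/funext => y; rewrite /swap_at /tr /=; do !case: ifP.
  rewrite e col_lt_irr /=; apply/funext => y /=; rewrite /tr.
  by case: eqP => [->//|_]; case: eqP => [->|].
- have [l|e] := mg _ _ h.
    rewrite l (col_lt_asym l) /=; case: c => //=.
    by apply/funext => y; rewrite /swap_at /tr /=; do !case: ifP.
  rewrite e col_lt_irr /=; case: c => //=; apply/funext => y /=; rewrite /tr.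
  by case: eqP => [->//|_]; case: eqP => [->|].
Qed.

Lemma coin_avg_color (g : config) Q ws st : mono_color g -> valid st ->
  coin_avg Q (g \o st.1) ws =
  foldr (avg rstep) (fun st => (`[< Q (g \o st.1) >])%:R) ws st.
Proof.
move=> mg; elim: ws st => //= z ws IH [p r] vst.
have n : p z != p (z + 1).
  by case: vst => /= h _; rewrite (inj_eq (can_inj h)); lia.
rewrite !(@W_step_color g _ z p r) // /avg.
by rewrite -!IH //; exact: valid_rstep.
Qed.

Lemma mono_three : mono_color eta0_three.
Proof.
move=> a b ab; rewrite /eta0_three.
by do !case: ifPn => /= ?; (try by [left|right]); lia.
Qed.

Lemma mono_two x : mono_color (@eta0_two R x).
Proof.
move=> a b ab; rewrite /eta0_two.
case: (leP b%:~R x) => hb; last by case: ifP => _; [left|right].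
suff -> : a%:~R <= x by right.
by apply: le_trans hb; rewrite ler_int ltW.
Qed.

Lemma coin_avg_rev (x : R) ws :
  coin_avg (fun eta => exists z : int, eta z = Some 2%Z /\ z%:~R <= x) eta0_three ws =
  coin_avg (fun eta => eta 0 = Some 1%Z) (eta0_two x) (rev ws).
Proof.
rewrite -[eta0_three]/(eta0_three \o id_state.1) -[eta0_two x]/(eta0_two x \o id_state.1).
rewrite !coin_avg_color; try exact: valid_id; [|exact: mono_two|exact: mono_three].
rewrite foldr_avg_rev foldr_avg_flip.
set F := (F in foldr _ F _ _); set G := (G in _ = foldr _ G _ _).
suff h ws' st : valid st ->
    foldr (avg rstep) F ws' st = foldr (avg rstep) G ws' st by exact: h.
elim: ws' st => [|z ws' IH] st vst /=; last by rewrite /avg !IH //; exact: valid_rstep.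
case: st vst => p r [/= h1 h2]; rewrite /F /G /=; congr (_%:R).
congr nat_of_bool; apply: asbool_equiv_eq; rewrite /eta0_two /eta0_three /=; split.
  move=> [z []]; case: ifP => // _; case: eqP => // rz _ zx.
  by rewrite -rz h2 zx.
case: ifP => // px _; exists (p 0); rewrite h1 ltxx eqxx; split => //.
Qed.

End Averaging.

(** * Independence *)

Section Independence.
Context d (T : measurableType d) (R : realType) (P : probability T R).
Context (I : choiceType) (X : I -> T -> R) (hX : mutually_independent P X).

Definition pr (A : set T) : R := fine (P A).

Lemma prE A : measurable A -> P A = (pr A)%:E.
Proof. by move=> mA; rewrite /pr fineK // fin_num_measure. Qed.

Lemma pr_ge0 A : 0 <= pr A.
Proof. by rewrite /pr fine_ge0. Qed.

Lemma pr_le A B : measurable A -> measurable B -> A `<=` B -> pr A <= pr B.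
Proof.
by move=> mA mB AB; rewrite -lee_fin -!prE //; apply: le_measure; rewrite ?inE.
Qed.

Lemma pr_le1 A : measurable A -> pr A <= 1.
Proof. by move=> mA; rewrite -lee_fin -prE // probability_le1. Qed.

Lemma prT : pr setT = 1.
Proof. by rewrite /pr probability_setT. Qed.

Lemma prC A : measurable A -> pr (~` A) = 1 - pr A.
Proof.
move=> mA; apply: EFin_inj; rewrite EFinB -!prE //; last exact: measurableC.
exact: probability_setC.
Qed.

Lemma prU A B : measurable A -> measurable B -> A `&` B = set0 ->
  pr (A `|` B) = pr A + pr B.
Proof.
move=> mA mB AB; apply: EFin_inj; rewrite EFinD -!prE //; last exact: measurableU.
exact: measureU.
Qed.

Lemma prIC A B : measurable A -> measurable B ->
  pr A = pr (A `&` B) + pr (A `&` ~` B).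
Proof.
move=> mA mB; rewrite -prU; last 1 first.
- by rewrite setIACA setICr setI0.
- by rewrite -setIUr setUCr setIT.
- exact: measurableI.
- by apply: measurableI => //; exact: measurableC.
Qed.

Definition rects (K : set I) : set (set T) :=
  [set A | exists J (B : I -> set R),
    [/\ uniq J, forall j, j \in J -> K j, forall j, measurable (B j) &
        A = \bigcap_(j in [set` J]) (X j @^-1` B j)]].

Lemma measurable_X i : measurable_fun setT (X i).
Proof. by case: hX. Qed.

Lemma measurable_preX i B : measurable B -> measurable (X i @^-1` B).
Proof. by move=> mB; rewrite -[X in measurable X]setTI; exact: measurable_X. Qed.

Lemma rects_setI K : setI_closed (rects K).
Proof.
move=> A A' [J [B [uJ KJ mB ->]]] [J' [B' [uJ' KJ' mB' ->]]].
exists (undup (J ++ J')), (fun j => (if j \in J then B j else setT) `&`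
  (if j \in J' then B' j else setT)); split.
- exact: undup_uniq.
- by move=> j; rewrite mem_undup mem_cat => /orP[/KJ|/KJ'].
- by move=> j; apply: measurableI; case: ifP.
- apply/seteqP; split=> w /=.
    move=> [h h'] j /=; rewrite mem_undup mem_cat => jJ.
    by split; case: ifP => // jj; [exact: h|exact: h'].
  move=> h; split=> j /= jJ.
    by have := h j; rewrite /= mem_undup mem_cat jJ => /(_ isT)[].
  by have := h j; rewrite /= mem_undup mem_cat jJ orbT => /(_ isT)[].
Qed.

Definition sigX (K : set I) : set (set T) := <<s rects K >>.

Lemma sigX_measurable K A : sigX K A -> measurable A.
Proof.
apply: smallest_sub => [|_ [J [B [uJ KJ mB ->]]]]; first exact: sigma_algebra_measurable.
rewrite bigcap_seq; apply: bigsetI_measurable => j _; exact: measurable_preX.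
Qed.

Lemma sigX_sub K K' : K `<=` K' -> sigX K `<=` sigX K'.
Proof.
move=> KK'; apply: sub_smallest2r; first exact: smallest_sigma_algebra.
move=> A [J [B [uJ KJ mB ->]]].
by exists J, B; split=> // j /KJ /KK'.
Qed.

Lemma sigX_preX (K : set I) i B : K i -> measurable B -> sigX K (X i @^-1` B).
Proof.
move=> Ki mB; apply: sub_sigma_algebra; exists [:: i], (fun=> B); split=> //.
- by move=> j; rewrite inE => /eqP ->.
- apply/seteqP; split=> w /=; first by move=> h j /=; rewrite inE => /eqP ->.
  by apply; rewrite /= inE.
Qed.

Lemma indep1 K i B A : ~ K i -> measurable B -> sigX K A ->
  pr (A `&` X i @^-1` B) = pr A * pr (X i @^-1` B).
Proof.
move=> Ki mB; set E := X i @^-1` B.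
have mE : measurable E by exact: measurable_preX.
suff: sigX K `<=` [set A | measurable A /\ (P (A `&` E) = P A * P E)%E].
  move=> /[apply] -[mA h]; apply: EFin_inj; rewrite EFinM -!prE //.
  exact: measurableI.
apply: lambda_system_subset; first exact: rects_setI; last by [].
- split=> //.
  + by split=> //; rewrite setTI probability_setT mul1e.
  + move=> A' B' B'A' [mA' hA'] [mB' hB']; split; first exact: measurableD.
    have mAE := measurableI _ _ mA' mE; have mBE := measurableI _ _ mB' mE.
    have fin C : measurable C -> (P C < +oo)%E.
      by move=> mC; rewrite -ge0_fin_numE // fin_num_measure.
    have -> : (A' `\` B') `&` E = (A' `&` E) `\` B'.
      by rewrite !setDE setIAC.
    rewrite (measureD mAE mB' (fin _ mAE)) (measureD mA' mB' (fin _ mA')).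
    have e : A' `&` E `&` B' = B' `&` E by rewrite setIAC (setIidr B'A').
    rewrite e (setIidr B'A').
    apply: (etrans (f_equal2 (fun x y => x - y)%E hA' hB')).
    apply/esym/muleBl; first exact: fin_num_measure.
    by apply: fin_num_adde_defl; rewrite fin_numN; exact: fin_num_measure.
  + move=> F ndF hF; have mF n : measurable (F n) by case: (hF n).
    have mU : measurable (\bigcup_n F n) by exact: bigcupT_measurable.
    split=> //.
    have c1 : (P \o F) n @[n --> \oo] --> P (\bigcup_n F n).
      exact: nondecreasing_cvg_mu.
    have c2 : (P \o (fun n => F n `&` E)) n @[n --> \oo] --> P (\bigcup_n F n `&` E).
      rewrite setI_bigcupl; apply: nondecreasing_cvg_mu.
      - by move=> n; exact: measurableI.
      - by rewrite -setI_bigcupl; exact: measurableI.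
      - by move=> m n mn; apply/subsetPset; apply: setSI; apply/subsetPset/ndF.
    have c3 := cvgeZr (fin_num_measure P _ mE) c1.
    apply: (cvg_unique _ c2); first exact: ereal_hausdorff.
    apply: cvg_trans c3; apply: near_eq_cvg; apply: nearW => n /=.
    by case: (hF n).
- move=> _ [J [B' [uJ KJ mB' ->]]]; split.
    by rewrite bigcap_seq; apply: bigsetI_measurable => j _; exact: measurable_preX.
  have iJ : i \notin J by apply/negP => /KJ.
  pose B2 j := if j == i then B else B' j.
  have BB j : j \in J -> B2 j = B' j.
    by move=> jJ; rewrite /B2; case: eqP => // ji; rewrite -ji jJ in iJ.
  have := hX.2 (i :: J) B2; rewrite /= iJ uJ => /(_ isT) /=.
  have mB2 j : measurable (B2 j) by rewrite /B2; case: ifP.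
  move=> /(_ mB2); rewrite big_cons {2}/B2 eqxx -/E.
  have := hX.2 J B' uJ mB'.
  have -> : \bigcap_(j in [set` i :: J]) (X j @^-1` B2 j) =
      \bigcap_(j in [set` J]) (X j @^-1` B' j) `&` E.
    rewrite bigcap_seq big_cons /B2 eqxx -/E setIC; congr (_ `&` _).
    by rewrite bigcap_seq; apply: eq_big_seq => j jJ; rewrite -/(B2 j) BB.
  move=> -> ->; rewrite muleC; congr (_ * _)%E; apply: eq_big_seq => j jJ.
  by rewrite BB.
Qed.

End Independence.

(** * Sums of exponential variables *)

Section RealAux.
Variable R : realType.
Implicit Types x y b : R.

Lemma le_of_inv_nat x y b : (forall n : nat, x <= y + b / n.+1%:R) -> x <= y.
Proof.
move=> h; rewrite leNgt; apply/negP => yx.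
have d0 : 0 < x - y by rewrite subr_gt0.
have [n nb] : exists n : nat, b / (x - y) < n.+1%:R.
  exists (Num.bound `|b / (x - y)|).
  apply: (le_lt_trans (ler_norm _)); apply: (lt_trans (archi_boundP (normr_ge0 _))).
  by rewrite ltr_nat.
have := h n; rewrite leNgt => /negP; apply.
rewrite -ltrBrDl ltr_pdivrMr // -ltr_pdivrMl //.
by rewrite mulrC.
Qed.

Lemma expR_sub1_le x : 0 <= x -> expR x - 1 <= x * expR x.
Proof.
move=> x0; rewrite lerBlDr -lerBlDl.
have := expR_ge1Dx (- x); rewrite -(ler_pM2l (expR_gt0 x)) -expRD subrr expR0.
by lra.
Qed.

End RealAux.

Section Exponential.
Context d (T : measurableType d) (R : realType) (P : probability T R).
Context (I : choiceType) (X : I -> T -> R) (hX : mutually_independent P X).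
Local Notation pr := (pr P).
Local Notation sigX := (sigX X).

Definition exponential (i : I) : Prop := forall s : R,
  P [set w | X i w <= s] = (if 0 <= s then 1 - expR (- s) else 0)%:E.

Definition sig_fun (K : set I) (Y : T -> R) : Prop :=
  forall B, measurable B -> sigX K (Y @^-1` B).

Lemma sigX_setI K A B : sigX K A -> sigX K B -> sigX K (A `&` B).
Proof. exact: (@measurableI _ (g_sigma_algebraType (rects X K))). Qed.

Lemma sigX_setT K : sigX K setT.
Proof. exact: (@measurableT _ (g_sigma_algebraType (rects X K))). Qed.

Lemma sig_funP K Y : sig_fun K Y <->
  measurable_fun setT (Y : g_sigma_algebraType (rects X K) -> R).
Proof.
split=> [h _ B mB|h B mB]; first by rewrite setTI; exact: h.
by rewrite -[_ @^-1` _]setTI; exact: h.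
Qed.

Lemma sig_funD K Y Z : sig_fun K Y -> sig_fun K Z -> sig_fun K (fun w => Y w + Z w).
Proof. by move=> /sig_funP mY /sig_funP mZ; apply/sig_funP/measurable_funD. Qed.

Lemma sig_fun_cst K x : sig_fun K (fun=> x).
Proof. by apply/sig_funP; exact: measurable_cst. Qed.

Lemma sig_funX (K : set I) i : K i -> sig_fun K (X i).
Proof. by move=> Ki B mB; exact: sigX_preX. Qed.

Lemma sig_fun_sub K K' Y : K `<=` K' -> sig_fun K Y -> sig_fun K' Y.
Proof. by move=> KK' mY B mB; apply: sigX_sub (mY _ mB). Qed.

Lemma sig_itv K Y a b : sig_fun K Y -> sigX K [set w | a < Y w <= b].
Proof.
move=> mY; have := mY `]a, b]%classic (measurable_itv _).
by congr sigX; apply/seteqP; split=> w /=; rewrite in_itv.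
Qed.

Lemma sig_gt K Y a : sig_fun K Y -> sigX K [set w | a < Y w].
Proof.
move=> mY; have := mY `]a, +oo[%classic (measurable_itv _).
by congr sigX; apply/seteqP; split=> w /=; rewrite in_itv /= andbT.
Qed.

Lemma indep_gt K i A s : ~ K i -> exponential i -> 0 <= s -> sigX K A ->
  pr (A `&` [set w | s < X i w]) = pr A * expR (- s).
Proof.
move=> Ki hi s0 mA.
have e : [set w | s < X i w] = X i @^-1` `]s, +oo[%classic.
  by apply/seteqP; split=> w /=; rewrite in_itv /= andbT.
rewrite e (indep1 hX Ki _ mA) //; congr (_ * _); rewrite -e.
have -> : [set w | s < X i w] = ~` [set w | X i w <= s].
  by apply/seteqP; split=> w /=; rewrite ltNge => /negP.
rewrite prC; first by rewrite /pr hi s0 /=; ring.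
have -> : [set w | X i w <= s] = X i @^-1` `]-oo, s]%classic.
  by apply/seteqP; split=> w /=; rewrite in_itv.
exact: measurable_preX hX _ _ _.
Qed.

Lemma pr_cells A (Y : T -> R) (v : nat -> R) n : measurable A ->
  (forall a b, measurable [set w | a < Y w <= b]) ->
  (forall j, v j <= v j.+1) ->
  pr (A `&` [set w | v 0%N < Y w <= v n]) =
  \sum_(j < n) pr (A `&` [set w | v j < Y w <= v j.+1]).
Proof.
move=> mA mY hv; elim: n => [|n IH].
  rewrite big_ord0 (_ : _ `&` _ = set0) ?/pr ?measure0 //.
  apply/seteqP; split=> w //= -[_ /andP[h1 h2]].
  by have := lt_le_trans h1 h2; rewrite ltxx.
rewrite big_ord_recr /= -IH -prU; last 1 first.
- apply/seteqP; split=> w //= -[[_ /andP[_ h1]] [_ /andP[h2 _]]].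
  by have := lt_le_trans h2 h1; rewrite ltxx.
- rewrite -setIUr; congr (pr (_ `&` _)); apply/seteqP; split=> w /=.
    by move=> /andP[-> ->]; case: leP => _; [left|right].
  have v0n : v 0%N <= v n by elim: n {IH} => // n IHn; exact: le_trans (hv n).
  move=> [/andP[-> h]|/andP[h ->]]; first by rewrite (le_trans h).
  by rewrite (le_lt_trans v0n).
- exact: measurableI.
- exact: measurableI.
Qed.

Section Grid.
Variables (a b : R) (n : nat).
Hypothesis ab : a <= b.
Definition grid (j : nat) : R := a + (b - a) / n.+1%:R * j%:R.

Lemma grid0 : grid 0 = a. Proof. by rewrite /grid mulr0 addr0. Qed.

Lemma gridn : grid n.+1 = b.
Proof. by rewrite /grid divfK ?pnatr_eq0 //; ring. Qed.

Lemma gridS j : grid j.+1 = grid j + (b - a) / n.+1%:R.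
Proof. by rewrite /grid -natr1; ring. Qed.

Lemma grid_mono j k : (j <= k)%N -> grid j <= grid k.
Proof.
move=> jk; rewrite lerD2l ler_wpM2l ?ler_nat // divr_ge0 ?ler0n //.
by rewrite subr_ge0.
Qed.

End Grid.

(* [Y] is cut into thin cells, on each of which [X i] is compared with an almost
   constant threshold. *)
Lemma memoryless K A Y i c e : ~ K i -> exponential i -> sigX K A ->
  sig_fun K Y -> (forall w, A w -> 0 <= Y w <= c) -> 0 <= c -> 0 <= e ->
  pr (A `&` [set w | c + e < Y w + X i w]) =
  expR (- e) * pr (A `&` [set w | c < Y w + X i w]).
Proof.
move=> Ki hi mA mY hY c0 e0.
pose K' := K `|` [set i].
have mYX : sig_fun K' (fun w => Y w + X i w).
  apply: sig_funD; first by apply: sig_fun_sub mY => ? ?; left.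
  by apply: sig_funX; right.
have mA' := sigX_measurable hX mA.
have mgt s : measurable [set w | s < Y w + X i w].
  by apply: (sigX_measurable hX); exact: sig_gt mYX.
have mcell u u' : measurable [set w | u < Y w <= u'].
  by apply: (sigX_measurable hX); exact: sig_itv mY.
pose F s := pr (A `&` [set w | c + s < Y w + X i w]).
suff main n s s' : 0 <= s -> 0 <= s' ->
    F s <= expR ((c + 1) / n.+1%:R) * expR (s' - s) * F s'.
  have F1 s : 0 <= F s <= 1 by rewrite pr_ge0 pr_le1 //; exact: measurableI.
  have -> : [set w | c < Y w + X i w] = [set w | c + 0 < Y w + X i w].
    by rewrite addr0.
  rewrite -/(F e) -/(F 0); apply/eqP; rewrite eq_le; apply/andP; split.
    apply: (@le_of_inv_nat _ _ _ ((c + 1) * expR (c + 1))) => n.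
    apply: le_trans (main n e 0 e0 (lexx 0)) _; rewrite sub0r.
    set u := (c + 1) / _; set y := expR (- e) * F 0.
  have u0 : 0 <= u by rewrite divr_ge0 //; lra.
    have uc : u <= c + 1 by rewrite ler_pdivrMr // ler_peMr ?ler1n //; lra.
    have y0 : 0 <= y by rewrite mulr_ge0 ?expR_ge0 // (andP (F1 0)).1.
    have y1 : y <= 1.
      rewrite mulr_ile1 ?expR_ge0 ?(andP (F1 0)).1 ?(andP (F1 0)).2 //.
      by rewrite -expR0 ler_expR oppr_le0.
    have h1 := expR_sub1_le u0.
    have h2 : u * expR u <= u * expR (c + 1) by rewrite ler_wpM2l // ler_expR.
    have h3 : (expR u - 1) * y <= u * expR (c + 1) * 1.
      have u1 : 0 <= expR u - 1 by rewrite subr_ge0 -expR0 ler_expR.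
      by apply: ler_pM => //; lra.
    rewrite -mulrA -/y mulrAC -/u; lra.
  apply: (@le_of_inv_nat _ _ _ ((c + 1) * expR (c + 1))) => n.
  have := main n 0 e (lexx 0) e0; rewrite subr0.
  set u := (c + 1) / _ => h.
  have u0 : 0 <= u by rewrite divr_ge0 //; lra.
  have uc : u <= c + 1 by rewrite ler_pdivrMr // ler_peMr ?ler1n //; lra.
  have {h} h : expR (- e) * F 0 <= expR u * F e.
    by rewrite expRN mulrC ler_pdivrMr ?expR_gt0 // mulrAC.
  have h1 := expR_sub1_le u0.
  have h2 : u * expR u <= u * expR (c + 1) by rewrite ler_wpM2l // ler_expR.
  have h3 : (expR u - 1) * F e <= u * expR (c + 1) * 1.
    have u1 : 0 <= expR u - 1 by rewrite subr_ge0 -expR0 ler_expR.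
    have /andP[Fe0 Fe1] := F1 e.
    by apply: ler_pM => //; lra.
  by rewrite mulrAC -/u; lra.
move=> s0 s0'.
pose v := grid (- 1) c n.
have c1 : - 1 <= c by lra.
have vS j : v j.+1 = v j + (c + 1) / n.+1%:R by rewrite /v gridS opprK.
have vc j : (j <= n.+1)%N -> v j <= c.
  by move=> jn; rewrite -[leRHS](gridn (- 1) c n) grid_mono.
have Fcells t : F t = \sum_(j < n.+1)
    pr (A `&` [set w | c + t < Y w + X i w] `&` [set w | v j < Y w <= v j.+1]).
  rewrite -pr_cells //; last 1 first.
  - by move=> j; rewrite grid_mono.
  - rewrite /F; congr pr; apply/seteqP; split=> w //= [].
      move=> Aw h; split=> //; have /andP[] := hY _ Aw.
      by rewrite /v grid0 gridn => Y0 ->; rewrite andbT; lra.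
    by move=> [].
  - exact: measurableI.
rewrite (Fcells s) (Fcells s') mulr_sumr; apply: ler_sum => j _.
pose Aj := A `&` [set w | v j < Y w <= v j.+1].
have mAj : sigX K Aj by apply: sigX_setI => //; exact: sig_itv.
have vj : v j.+1 <= c by apply: vc.
have mAj' := sigX_measurable hX mAj.
have mX t : measurable [set w | t < X i w].
  by apply: (sigX_measurable hX); apply: (@sig_gt K'); apply: sig_funX; right.
have up : pr (A `&` [set w | c + s < Y w + X i w] `&` [set w | v j < Y w <= v j.+1])
    <= pr Aj * expR (- (c + s - v j.+1)).
  rewrite -(indep_gt Ki hi) //; last by lra.
  apply: pr_le; try exact: measurableI; first by do 2 apply: measurableI => //.
  by move=> w /= [[Aw h] /andP[h1 h2]]; split; [split=> //; apply/andP|lra].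
have lo : pr Aj * expR (- (c + s' - v j)) <=
    pr (A `&` [set w | c + s' < Y w + X i w] `&` [set w | v j < Y w <= v j.+1]).
  rewrite -(indep_gt Ki hi) //; last by have := vS j; have := vc j (ltnW (ltn_ord j)); lra.
  apply: pr_le; try exact: measurableI; first by do 2 apply: measurableI => //.
  by move=> w /= [[Aw /andP[h1 h2]] h]; split; [split=> //; lra|apply/andP].
apply: (le_trans up).
apply: le_trans (ler_wpM2l _ lo); last by rewrite mulr_ge0 ?expR_ge0.
rewrite mulrCA -!expRD ler_wpM2l ?pr_ge0 // ler_expR vS.
set u := _ / _; lra.
Qed.

(* A point of a unit Poisson process in the slot ]a, b], none in ]b, L]: on a thin
   cell of [Y + X i] the requirement on [X i'] is almost deterministic, and the
   factor exp(- (L - c)) compensates the density of [Y + X i] at c. *)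
Lemma split_cell K A Y i i' a b L : ~ K i -> ~ K i' -> i != i' ->
  exponential i -> exponential i' -> sigX K A -> sig_fun K Y ->
  (forall w, A w -> 0 <= Y w <= a) -> 0 <= a -> a <= b -> b <= L ->
  pr (A `&` [set w | a < Y w + X i w <= b] `&` [set w | L < Y w + X i w + X i' w]) =
  (b - a) * pr (A `&` [set w | L < Y w + X i w]).
Proof.
move=> Ki Ki' ii' hi hi' mA mY hY a0 ab bL.
pose Z w := Y w + X i w.
pose K1 := K `|` [set i]; pose K2 := K1 `|` [set i'].
have K1i' : ~ K1 i' by case=> // /= /eqP; rewrite eq_sym (negbTE ii').
have mZ : sig_fun K1 Z.
  apply: sig_funD; first by apply: sig_fun_sub mY => ? ?; left.
  by apply: sig_funX; right.
have mZX : sig_fun K2 (fun w => Z w + X i' w).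
  apply: sig_funD; first by apply: sig_fun_sub mZ => ? ?; left.
  by apply: sig_funX; right.
have mA1 : sigX K1 A by apply: sigX_sub mA => ? ?; left.
have mAT := sigX_measurable hX mA.
have mcell u u' : measurable [set w | u < Z w <= u'].
  by apply: (sigX_measurable hX); exact: sig_itv mZ.
have mgt u : measurable [set w | u < Z w].
  by apply: (sigX_measurable hX); exact: sig_gt mZ.
have mgt2 : measurable [set w | L < Z w + X i' w].
  by apply: (sigX_measurable hX); exact: sig_gt mZX.
have mX t : measurable [set w | t < X i' w].
  by apply: (sigX_measurable hX); apply: (@sig_gt K2); apply: sig_funX; right.
set w0 := pr (A `&` [set w | L < Y w + X i w]).
have w00 : 0 <= w0 by exact: pr_ge0.
have w01 : w0 <= 1 by apply: pr_le1; exact: measurableI.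
have tail c : a <= c <= L -> pr (A `&` [set w | c < Z w]) = expR (L - c) * w0.
  move=> /andP[ac cL]; rewrite /w0.
  have -> : [set w | L < Y w + X i w] = [set w | c + (L - c) < Y w + X i w].
    by have -> : c + (L - c) = L by lra.
  rewrite (@memoryless K) //; [|move=> w /hY; lra|lra|lra].
  by rewrite mulrA -expRD subrr expR0 mul1r.
have hcell c c' : a <= c -> c <= c' -> c' <= L ->
    pr (A `&` [set w | c < Z w <= c']) = (expR (L - c) - expR (L - c')) * w0.
  move=> ac cc cL; rewrite mulrBl -!tail; [|lra|lra].
  rewrite (@prIC _ _ _ _ (A `&` [set w | c < Z w]) [set w | c' < Z w]) //;
    last exact: measurableI.
  have -> : A `&` [set w | c < Z w] `&` [set w | c' < Z w] = A `&` [set w | c' < Z w].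
    by apply/seteqP; split=> w /= => [[[]]|[Aw h]] //; split=> //; split=> //; lra.
  rewrite [RHS]addrC addKr; congr pr; apply/seteqP; split=> w /=.
    by move=> [Aw /andP[h1 h2]]; split=> //; apply/negP; lra.
  by move=> [[Aw h] /negP h2]; split=> //; lra.
rewrite setIAC.
set G := A `&` _.
have mG : measurable G by exact: measurableI.
have cells n := @pr_cells G Z (grid a b n) n.+1 mG mcell
  (fun j => grid_mono n ab (leqnSn j)).
have gL n j : (j <= n.+1)%N -> grid a b n j <= L.
  by move=> jn; apply: le_trans bL; rewrite -[leRHS](gridn a b n) grid_mono.
have ga n j : a <= grid a b n j by rewrite -{1}(grid0 a b n) grid_mono.
pose e n := (b - a) / n.+1%:R.
have e0 n : 0 <= e n by rewrite divr_ge0 ?subr_ge0 ?ler0n.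
have up n : pr (G `&` [set w | a < Z w <= b]) <= n.+1%:R * (w0 * (expR (e n) - 1)).
  have := cells n; rewrite grid0 gridn => ->.
  rewrite mulr_natl -[X in _ *+ X]card_ord -sumr_const; apply: ler_sum => j _.
  set c := grid a b n j; set c' := grid a b n j.+1.
  have c'E : c' = c + e n by rewrite /c' gridS.
  have c'L : c' <= L by apply: gL.
  have ac : a <= c by exact: ga.
  apply: (@le_trans _ _ (pr (A `&` [set w | c < Z w <= c']) * expR (- (L - c')))).
    rewrite -(indep_gt K1i' hi'); [|lra|by apply: sigX_setI => //; exact: sig_itv].
    apply: pr_le; try exact: measurableI; first by do 2 apply: measurableI => //.
    move=> w /= [[Aw h] /andP[h1 h2]]; split; first by split=> //; apply/andP.
    by move: h h2; rewrite /Z /=; lra.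
  rewrite hcell //; last by have := e0 n; lra.
  rewrite mulrAC mulrBl -!expRD (_ : L - c - (L - c') = e n) ?subrr ?expR0 1?mulrC //.
  by lra.
have lo n : n.+1%:R * (w0 * (1 - expR (- e n))) <= pr (G `&` [set w | a < Z w <= b]).
  have := cells n; rewrite grid0 gridn => ->.
  rewrite mulr_natl -[X in _ *+ X]card_ord -sumr_const; apply: ler_sum => j _.
  set c := grid a b n j; set c' := grid a b n j.+1.
  have c'E : c' = c + e n by rewrite /c' gridS.
  have c'L : c' <= L by apply: gL.
  have ac : a <= c by exact: ga.
  have en := e0 n.
  apply: (@le_trans _ _ (pr (A `&` [set w | c < Z w <= c']) * expR (- (L - c)))).
    rewrite hcell //; last by lra.
    rewrite mulrAC mulrBl -!expRD subrr expR0 1?mulrC.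
    by rewrite (_ : L - c' - (L - c) = - e n) ?lexx //; lra.
  rewrite -(indep_gt K1i' hi'); [|lra|by apply: sigX_setI => //; exact: sig_itv].
  apply: pr_le; try exact: measurableI; first by do 2 apply: measurableI => //.
  move=> w /= [[Aw /andP[h1 h2]] h]; split; last exact/andP.
  by split=> //; move: h h1; rewrite /Z /=; lra.
have en n : n.+1%:R * e n = b - a by rewrite mulrC divfK // pnatr_eq0.
have elt n : e n <= b - a by rewrite ler_pdivrMr // ler_peMr ?ler1n //; lra.
apply/eqP; rewrite eq_le; apply/andP; split.
  apply: (@le_of_inv_nat _ _ _ ((b - a) * (b - a) * expR (b - a))) => n.
  apply: le_trans (up n) _.
  have h1 := expR_sub1_le (e0 n).
  have h2 : expR (e n) <= 1 + e n * expR (b - a).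
    have : e n * expR (e n) <= e n * expR (b - a) by rewrite ler_wpM2l // ler_expR.
    lra.
  have h3 : e n * expR (e n) <= e n * (1 + e n * expR (b - a)) by rewrite ler_wpM2l.
  have h4 : w0 * (expR (e n) - 1) <= w0 * (e n * (1 + e n * expR (b - a))).
    by rewrite ler_wpM2l //; lra.
  rewrite -(ler_pM2l (ltr0Sn R n)) in h4; apply: le_trans h4 _.
  rewrite [leLHS](_ : _ = (n.+1%:R * e n) * w0 +
    w0 * ((n.+1%:R * e n) * e n * expR (b - a))); last by ring.
  rewrite en lerD2l [leRHS](_ : _ = (b - a) * e n * expR (b - a)); last by rewrite /e; ring.
  by rewrite ler_piMl // !mulr_ge0 ?expR_ge0 // subr_ge0.
apply: (@le_of_inv_nat _ _ _ ((b - a) * (b - a))) => n.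
rewrite -lerBlDr; apply: le_trans (lo n).
have h1 : e n - e n * e n <= 1 - expR (- e n).
  have := expR_ge1Dx (e n); have := expR_ge1Dx (- e n).
  have := expRxMexpNx_1 (e n); have := e0 n; have := expR_gt0 (e n); have := expR_gt0 (- e n).
  by nra.
have h4 : w0 * (e n - e n * e n) <= w0 * (1 - expR (- e n)) by rewrite ler_wpM2l.
rewrite -(ler_pM2l (ltr0Sn R n)) in h4; apply: le_trans h4.
rewrite [leRHS](_ : _ = (n.+1%:R * e n) * w0 - w0 * ((n.+1%:R * e n) * e n)); last by ring.
rewrite en lerD2l lerN2 [leRHS](_ : _ = (b - a) * e n); last by rewrite /e; ring.
by rewrite ler_piMl // mulr_ge0 // subr_ge0.
Qed.

End Exponential.

(** * Coins and slot patterns *)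

Lemma bigcup_measurable_count d (T : measurableType d) (U : countType)
    (D : set U) (F : U -> set T) :
  (forall i, D i -> measurable (F i)) -> measurable (\bigcup_(i in D) F i).
Proof.
move=> mF; rewrite bigcup_mkcond; apply: countable_bigcupT_measurable => // i.
by case: ifPn => // /set_mem /mF.
Qed.

Lemma bigcap_measurable_count d (T : measurableType d) (U : countType)
    (D : set U) (F : U -> set T) :
  (forall i, D i -> measurable (F i)) -> measurable (\bigcap_(i in D) F i).
Proof.
move=> mF; rewrite -[X in measurable X]setCK setC_bigcap; apply: measurableC.
by apply: bigcup_measurable_count => i /mF; exact: measurableC.
Qed.

Section Patterns.
Context d (T : measurableType d) (R : realType) (P : probability T R).
Context (X : int * nat * bool -> T -> R) (hX : clock_family P X).
Local Notation pr := (pr P).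
Local Notation sigX := (sigX X).
Local Notation sig_fun := (sig_fun X).

Let indX : mutually_independent P X := hX.1.

Lemma expX z k : exponential P X (z, k, false).
Proof. exact: hX.2.1 z k. Qed.

Lemma sig_coin (K : set (int * nat * bool)) p (q : R) : K (p, true) ->
  sigX K [set w | X (p, true) w < q].
Proof.
move=> Kp; have := @sigX_preX _ _ _ _ X K (p, true) `]-oo, q[%classic Kp (measurable_itv _).
by congr sigX; apply/seteqP; split=> w /=; rewrite in_itv.
Qed.

Lemma pr_coin p (q : R) : 0 <= q <= 1 -> pr [set w | X (p, true) w < q] = q.
Proof.
move=> /andP[q0 q1]; case: p => z k.
have cdf s : pr [set w | X (z, k, true) w <= s] = Num.min (Num.max s 0) 1.
  by rewrite /pr hX.2.2.
have mle s : measurable [set w | X (z, k, true) w <= s].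
  rewrite (_ : [set w | _] = X (z, k, true) @^-1` `]-oo, s]%classic); last first.
    by apply/seteqP; split=> w /=; rewrite in_itv.
  exact: measurable_preX indX _ _ _.
have mlt : measurable [set w | X (z, k, true) w < q].
  exact: (sigX_measurable indX (@sig_coin setT (z, k) q I)).
apply/eqP; rewrite eq_le; apply/andP; split.
  apply: (@le_trans _ _ (pr [set w | X (z, k, true) w <= q])).
    by apply: pr_le => // w /= /ltW.
  by rewrite cdf ge_min ge_max lexx q0.
apply: (@le_of_inv_nat _ _ _ 1) => n.
have : 0 < 1 / n.+1%:R :> R by rewrite divr_gt0.
move: (1 / _) => u u0.
rewrite -lerBlDr; apply: (@le_trans _ _ (pr [set w | X (z, k, true) w <= q - u])).
  by rewrite cdf le_min le_max lexx /=; lra.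
by apply: pr_le => // w /=; lra.
Qed.

Lemma run_setE (q : R) (Q : config -> Prop) eta p s :
  [set w | Q (run q (Ufam X w) eta (p :: s))] =
  ([set w | X (p, true) w < q] `&` [set w | Q (run q (Ufam X w) (W_step true p.1 eta) s)])
  `|` (~` [set w | X (p, true) w < q] `&`
       [set w | Q (run q (Ufam X w) (W_step false p.1 eta) s)]).
Proof.
case: p => z k; apply/seteqP; split=> w; rewrite /run /= -/(run q (Ufam X w)) /Ufam.
  by case: ltP => h; [left|right; split=> //; apply/negP; rewrite -leNgt].
by case=> -[]; [move=> ->|move=> /negP/negbTE ->].
Qed.

Lemma measurable_run (q : R) (Q : config -> Prop) eta s :
  measurable [set w | Q (run q (Ufam X w) eta s)].
Proof.
elim: s eta => [|p s IH] eta.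
  rewrite (_ : [set w | _] = if `[< Q eta >] then setT else set0).
    by case: ifP.
  by apply/seteqP; split=> w /=; rewrite /run /=; case: asboolP.
have m := sigX_measurable indX (@sig_coin setT p q I).
rewrite run_setE; apply: measurableU; apply: measurableI => //.
exact: measurableC.
Qed.

Lemma pr_run (q : R) (Q : config -> Prop) K A s eta : 0 <= q <= 1 ->
  sigX K A -> uniq s -> (forall p, p \in s -> ~ K (p, true)) ->
  pr (A `&` [set w | Q (run q (Ufam X w) eta s)]) =
  pr A * coin_avg q Q eta (map fst s).
Proof.
move=> hq; elim: s K A eta => [|p s IH] K A eta mA.
  move=> _ _; rewrite /run /=; case: asboolP => Qe.
    by rewrite mulr1; congr pr; apply/seteqP; split=> w //= [].
  by rewrite mulr0 (_ : _ `&` _ = set0) ?/pr ?measure0 //; apply/seteqP; split=> w //= [].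
move=> /= /andP[ps us] hK.
have Kp : ~ K (p, true) by apply: hK; rewrite inE eqxx.
have hK' r : r \in s -> ~ (K `|` [set (p, true)]) (r, true).
  move=> rs; case=> [|/= [rp]]; first by apply: hK; rewrite inE rs orbT.
  by move: ps; rewrite -rp rs.
have mC := @sig_coin (K `|` [set (p, true)]) p q (or_intror erefl).
have mC' : sigX (K `|` [set (p, true)]) (~` [set w | X (p, true) w < q]).
  exact: (@measurableC _ (g_sigma_algebraType (rects X (K `|` [set (p, true)])))).
have mA' : sigX (K `|` [set (p, true)]) A by apply: sigX_sub mA => ? ?; left.
have mAT := sigX_measurable indX mA.
have mCT := sigX_measurable indX mC.
have mR c := measurable_run q Q (W_step c p.1 eta) s.
rewrite run_setE setIUr !setIA prU; last 1 first.
- by apply/seteqP; split=> w //= [[[_ h] _] [[_ h'] _]].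
- rewrite (IH _ _ _ (sigX_setI mA' mC) us hK').
  rewrite (IH _ _ _ (sigX_setI mA' mC') us hK').
  have e : [set w | X (p, true) w < q] = X (p, true) @^-1` `]-oo, q[%classic.
    by apply/seteqP; split=> w /=; rewrite in_itv.
  have e1 : pr (A `&` [set w | X (p, true) w < q]) = pr A * q.
    by rewrite -{2}(pr_coin p hq) {1}e (indep1 indX Kp _ mA) // -e.
  have e2 : pr (A `&` ~` [set w | X (p, true) w < q]) = pr A * (1 - q).
    have := prIC P mAT mCT; rewrite e1; lra.
  by rewrite e1 e2; ring.
- by do 2 apply: measurableI => //.
- by do 2 apply: measurableI => //; exact: measurableC.
Qed.

Lemma pr_bigcap (l : seq int) (B : int -> set R) : uniq l ->
  (forall z, measurable (B z)) ->
  pr (\bigcap_(z in [set` l]) (X (z, 0%N, false) @^-1` B z)) =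
  \prod_(z <- l) pr (X (z, 0%N, false) @^-1` B z).
Proof.
move=> ul mB; have := indX.2 [seq (z, 0%N, false) | z <- l] (fun j => B j.1.1).
rewrite map_inj_uniq; last by move=> x y [].
move=> /(_ ul (fun j => mB j.1.1)); rewrite big_map.
have -> : \bigcap_(j in [set` [seq (z, 0%N, false) | z <- l]]) (X j @^-1` B j.1.1)
    = \bigcap_(z in [set` l]) (X (z, 0%N, false) @^-1` B z).
  apply/seteqP; split=> w h.
    by move=> z /= zl; apply: (h (z, 0%N, false)); apply: map_f.
  by move=> _ /= /mapP[z zl ->]; exact: (h z).
have -> : (\big[*%E/1%E]_(j <- l) P (X (j, 0%N, false) @^-1` B (j, 0%N, false).1.1)
    = (\prod_(z <- l) pr (X (z, 0%N, false) @^-1` B z))%:E)%E.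
  elim: l {ul} => [|z l IH]; first by rewrite !big_nil.
  rewrite !big_cons IH EFinM -prE //.
  exact: measurable_preX indX _ _ _.
by rewrite /pr => ->.
Qed.

Section Cells.
Variables (a : int -> nat -> R) (N M : nat).
Hypothesis a0 : forall z, a z 0 = 0.
Hypothesis a_mono : forall z i, a z i <= a z i.+1.

Lemma a_le z i j : (i <= j)%N -> a z i <= a z j.
Proof. by move=> ij; apply: (homo_leq (@lexx _ R) le_trans (a_mono z)). Qed.

Lemma a_ge0 z i : 0 <= a z i.
Proof. by rewrite -(a0 z) a_le. Qed.

(* Column [i] of a pattern [f] holds the bond that rings in slot [i], if any, and
   [a z i] is the Poisson clock of bond [z] at the start of slot [i]. *)
Definition count_bond (f : nat -> option int) (z : int) (n : nat) : nat :=
  \sum_(i < n) (f i == Some z).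

Definition point_time z k (w : T) : R := Sk (Efam X w) z k.

Fixpoint in_cells (f : nat -> option int) (n : nat) : set T :=
  if n is n'.+1 then
    in_cells f n' `&`
    (if f n' is Some z then
       [set w | a z n' < point_time z (count_bond f z n') w <= a z n'.+1]
     else setT)
  else setT.

Definition bonds : set int := [set z | `|z| <= M%:Z].

Definition no_more (f : nat -> option int) (n : nat) : set T :=
  \bigcap_(z in bonds) [set w | a z N < point_time z (count_bond f z n) w].

Definition weight (o : option int) (i : nat) : R :=
  if o is Some z then a z i.+1 - a z i else 1.

Lemma count_bondS f z n :
  count_bond f z n.+1 = (count_bond f z n + (f n == Some z))%N.
Proof. by rewrite /count_bond big_ord_recr. Qed.

Lemma count_bond_le f z m n : (m <= n)%N -> (count_bond f z m <= count_bond f z n)%N.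
Proof.
apply: (homo_leq leqnn leq_trans) => i; by rewrite count_bondS leq_addr.
Qed.

Lemma count_bond_lt f z m n : (m < n)%N -> f m = Some z ->
  (count_bond f z m < count_bond f z n)%N.
Proof.
move=> mn fm; apply: leq_trans (count_bond_le f z mn).
by rewrite count_bondS fm eqxx addn1.
Qed.

Lemma sig_sum K z k : (forall i, (i < k)%N -> K (z, i, false)) ->
  sig_fun K (fun w => \sum_(i < k) X (z, i : nat, false) w).
Proof.
elim: k => [|k IH] hK.
  under eq_fun do rewrite big_ord0; exact: sig_fun_cst.
under eq_fun do rewrite big_ord_recr /=; apply: sig_funD.
  by apply: IH => i ik; apply: hK; apply: ltnW.
by apply: sig_funX; apply: hK.
Qed.

Lemma sig_point_time K z k : (forall i, (i <= k)%N -> K (z, i, false)) ->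
  sig_fun K (point_time z k).
Proof. by move=> hK; apply: (@sig_sum K z k.+1). Qed.

Lemma point_timeS z k w :
  point_time z k.+1 w = point_time z k w + X (z, k.+1, false) w.
Proof. by rewrite /point_time /Sk big_ord_recr. Qed.

Lemma sig_in_cells K f n :
  (forall i z k, (i < n)%N -> f i = Some z -> (k <= count_bond f z i)%N ->
    K (z, k, false)) -> sigX K (in_cells f n).
Proof.
elim: n => [|n IH] hK /=; first exact: sigX_setT.
apply: sigX_setI; first by apply: IH => i z k /ltnW /hK; apply.
case fn: (f n) => [z|]; last exact: sigX_setT.
by apply: sig_itv; apply: sig_point_time => k; exact: hK.
Qed.

Lemma sig_bigcap K (D : set int) (F : int -> set T) :
  (forall z, D z -> sigX K (F z)) -> sigX K (\bigcap_(z in D) F z).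
Proof.
exact: (@bigcap_measurable_count _ (g_sigma_algebraType (rects X K)) int).
Qed.

Lemma in_cells_sum f n z w : in_cells f n w ->
  0 <= \sum_(i < count_bond f z n) X (z, i : nat, false) w <= a z n.
Proof.
elim: n => [|n IH] /=; first by rewrite /count_bond !big_ord0 a0 lexx.
move=> [/IH /andP[h1 h2]]; rewrite count_bondS; case: eqP => [->|fz].
  move=> /= /andP[h3 h4]; rewrite addn1; apply/andP; split=> //.
  by apply: (le_trans (a_ge0 z n)); exact: ltW.
by rewrite addn0 h1 (le_trans h2).
Qed.

Lemma pr_pattern f n : (n <= N)%N ->
  (forall i z, (i < n)%N -> f i = Some z -> bonds z) ->
  pr (in_cells f n `&` no_more f n) =
  pr (no_more f 0) * \prod_(i < n) weight (f i) i.
Proof.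
elim: n => [|n IH] nN hf; first by rewrite big_ord0 mulr1 /= setTI.
rewrite big_ord_recr mulrA -IH; [|exact: ltnW|by move=> i z /ltnW; exact: hf].
case fn: (f n) => [z|]; last first.
  rewrite /= fn setIT mulr1; congr (pr (_ `&` _)).
  by apply: eq_bigcapr => z _; rewrite count_bondS fn addn0.
set k := count_bond f z n.
pose other := \bigcap_(y in bonds `\ z) [set w | a y N < point_time y (count_bond f y n) w].
have zb : bonds z by exact: hf fn.
have tailE m : (forall y, y != z -> count_bond f y m = count_bond f y n) ->
    no_more f m = other `&` [set w | a z N < point_time z (count_bond f z m) w].
  move=> h; apply/seteqP; split=> w.
    by move=> hw; split; [move=> y [yb /eqP yz] /=; rewrite -h //; exact: hw|exact: hw].
  move=> [h1 h2] y yb; have [->//|yz] := eqVneq y z.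
  by rewrite /= h //; apply: h1; split=> //; exact/eqP.
rewrite (tailE n) // (tailE n.+1) => [|y yz]; last first.
  by rewrite count_bondS fn (inj_eq Some_inj) eq_sym (negbTE yz) addn0.
rewrite count_bondS fn eqxx addn1 -/k.
pose K := [set j : int * nat * bool | (j.1.1 = z -> (j.1.2 < k)%N) /\ j.2 = false].
pose Y w := \sum_(i < k) X (z, i : nat, false) w.
have mY : sig_fun K Y by apply: sig_sum.
pose H := in_cells f n `&` other.
have mH : sigX K H.
  apply: sigX_setI.
    apply: sig_in_cells => i y k' i_n fi k'c; split=> //= yz.
    by apply: leq_ltn_trans k'c _; rewrite /k -yz; exact: count_bond_lt.
  apply: sig_bigcap => y [yb yz]; apply: sig_gt; apply: sig_point_time => i _.
  by split.
have hk : ~ K (z, k, false) by case=> /= /(_ erefl); rewrite ltnn.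
have hk' : ~ K (z, k.+1, false) by case=> /= /(_ erefl); rewrite ltnNge leqnSn.
have kk : (z, k, false) != (z, k.+1, false).
  by apply/eqP => -[] /eqP; rewrite eqn_leq ltnn andbF.
have hY w : H w -> 0 <= Y w <= a z n by move=> [hw _]; exact: in_cells_sum hw.
have := split_cell indX hk hk' kk (expX _ _) (expX _ _) mH mY hY (a_ge0 z n)
  (a_mono z n) (a_le z nN).
have YE w : Y w + X (z, k, false) w = point_time z k w.
  by rewrite /point_time /Sk big_ord_recr.
rewrite /= fn mulrC -/k => E.
apply: etrans (etrans E _).
  congr pr; apply/seteqP; split=> w /=; rewrite YE point_timeS.
    by move=> [[h1 h2] [h3 h4]].
  by move=> [[[h1 h2] h3] h4].
congr (pr _ * _); apply/seteqP; split=> w /=; rewrite YE.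
  by move=> [[h1 h2] h3].
by move=> [h1 [h2 h3]].
Qed.

End Cells.
End Patterns.

(** * The graphical construction *)

Section Listings.
Variables (R : realType) (r : int -> R -> R) (E : int -> nat -> R).
Hypothesis Lam_mono : forall z s t, 0 <= s -> s <= t -> Lam r z s <= Lam r z t.

Let earlier (p p' : int * nat) : bool := `[< before r E p p' >].

Lemma before_trans : transitive earlier.
Proof.
move=> p1 p0 p2 /asboolP[t [t0 [h1 h2]]] /asboolP[t' [t0' [h1' h2']]].
apply/asboolP; exists t'; split=> //; split=> //; apply: (le_trans h1); apply: Lam_mono => //.
by case: (leP t t') => // /ltW /(Lam_mono p1.1 t0'); lra.
Qed.

Lemma before_irr : irreflexive earlier.
Proof. by move=> p; apply/asboolP => -[t [t0 [h1 h2]]]; lra. Qed.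

Lemma listing_uniq M t s s' : listing r E M t s -> listing r E M t s' -> s = s'.
Proof.
move=> [us [ms ss]] [us' [ms' ss']].
apply: (irr_sorted_eq before_trans before_irr ss ss') => p.
by apply/idP/idP => /[dup] _; [move=> /ms /ms'|move=> /ms' /ms].
Qed.

Lemma listing_filter M n t s : (n <= M)%N -> listing r E M t s ->
  listing r E n t [seq p <- s | (`|p.1| <= n%:Z)%R].
Proof.
move=> nM [us [ms ss]]; split; first exact: filter_uniq.
split; last exact: (sorted_filter before_trans).
move=> p; rewrite mem_filter; split.
  by move=> /andP[-> /ms[]].
move=> [pn h]; rewrite pn; apply/ms; split=> //.
by apply: le_trans pn _; rewrite lez_nat.
Qed.

Hypothesis E_gt0 : forall z k, 0 < E z k.

Lemma Sk_le z k k' : (k <= k')%N -> Sk E z k <= Sk E z k'.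
Proof.
apply: (homo_leq (@lexx _ R) le_trans) => i.
by rewrite /Sk [leRHS]big_ord_recr lerDl ltW.
Qed.

Section FromPattern.
Variables (tau : R) (N M : nat) (f : nat -> option int).
Hypothesis tau0 : 0 <= tau.
Let a z i := Lam r z (grid 0 tau N i).

Fixpoint points (n : nat) : seq (int * nat) :=
  if n is n'.+1 then
    if f n' is Some z then rcons (points n') (z, count_bond f z n') else points n'
  else [::].

Lemma mem_points z k n : (k < count_bond f z n)%N -> (z, k) \in points n.
Proof.
elim: n => [|n IH]; first by rewrite /count_bond big_ord0.
rewrite count_bondS /=; case: (f n) => [y|]; last by rewrite addn0.
rewrite mem_rcons inE (inj_eq Some_inj); have [->|yz] := eqVneq y z.
  by rewrite addn1 ltnS leq_eqVlt => /orP[/eqP ->|/IH ->]; rewrite ?eqxx ?orbT.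
by rewrite addn0 => /IH ->; rewrite orbT.
Qed.

Hypothesis cells : forall n z, (n < N.+1)%N -> f n = Some z ->
  `|z| <= M%:Z /\ a z n < Sk E z (count_bond f z n) <= a z n.+1.

Lemma points_bound n p : (n <= N.+1)%N -> p \in points n ->
  `|p.1| <= M%:Z /\ Sk E p.1 p.2 <= a p.1 n.
Proof.
have g0 i : 0 <= grid 0 tau N i.
  by rewrite -{1}(grid0 0 tau N) grid_mono.
have amono z i : a z i <= a z i.+1.
  by apply: Lam_mono; rewrite ?grid_mono.
elim: n p => [//|n IH] p nN /=.
case fn: (f n) => [z|]; last first.
  move=> /(IH _ (ltnW nN))[h1 h2]; split=> //; exact: le_trans (amono _ _).
have [h1 /andP[_ h2]] := cells nN fn.
rewrite mem_rcons inE => /orP[/eqP ->//|/(IH _ (ltnW nN))[h3 h4]].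
by split=> //; exact: le_trans (amono _ _).
Qed.

Lemma points_pairwise n : (n <= N.+1)%N -> pairwise earlier (points n).
Proof.
elim: n => [//|n IH] nN /=; have IHn := IH (ltnW nN).
case fn: (f n) => [z|] //; rewrite pairwise_rcons IHn andbT.
apply/allP => p pn; apply/asboolP; exists (grid 0 tau N n).
have [h1 /andP[h2 _]] := cells nN fn.
split; first by rewrite -{1}(grid0 0 tau N) grid_mono.
by split=> //; exact: (points_bound (ltnW nN) pn).2.
Qed.

Hypothesis rest : forall z, `|z| <= M%:Z ->
  a z N.+1 < Sk E z (count_bond f z N.+1).

Lemma points_listing : listing r E M tau (points N.+1).
Proof.
have aE z : a z N.+1 = Lam r z tau by rewrite /a gridn.
have ss : sorted earlier (points N.+1).
  by apply: pairwise_sorted; exact: points_pairwise.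
split; first exact: (sorted_uniq before_trans before_irr ss).
split=> // p; split.
  by move=> /points_bound; rewrite aE; exact.
case: p => z k [zM h]; apply: mem_points.
have {}h : Sk E z k <= a z N.+1 by rewrite aE.
rewrite ltnNge; apply/negP => /(Sk_le z) h'.
have := rest zM; lra.
Qed.

End FromPattern.

Definition block (bl br y : int) : bool := (bl < y) && (y <= br).

Definition local_at (q : R) (U : int -> nat -> R) (eta0 : config) (Q : config -> Prop)
    (bl br : int) : Prop :=
  forall s : seq (int * nat), (forall p, p \in s -> p.1 != bl /\ p.1 != br) ->
    Q (run q U eta0 s) <-> Q (run q U eta0 [seq p <- s | block bl br p.1]).

Definition asep_at (q : R) (eta0 : config) (t : R) (U : int -> nat -> R)
    (Q : config -> Prop) (M : nat) : Prop :=
  exists s, listing r E M t s /\ Q (run q U eta0 s).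

Lemma asep_event_stable q eta0 t U Q n (bl br : int) :
  (forall M, exists s, listing r E M t s) ->
  local_at q U eta0 Q bl br ->
  Lam r bl t < E bl 0 -> Lam r br t < E br 0 -> - n%:Z <= bl -> br <= n%:Z ->
  asep_event r q eta0 t E U Q <-> asep_at q eta0 t U Q n.
Proof.
move=> hex hloc hbl hbr nbl brn.
have stable M : (n <= M)%N -> asep_at q eta0 t U Q M <-> asep_at q eta0 t U Q n.
  move=> nM; have [s hs] := hex M; have hs' := listing_filter nM hs.
  set s' := [seq p <- s | _] in hs'.
  have noempty p z : p \in s -> Lam r z t < E z 0 -> p.1 != z.
    move=> /hs.2.1[_ h]; apply: contraTneq => <-; rewrite -leNgt; apply: le_trans h.
    by apply: le_trans (Sk_le _ (leq0n _)); rewrite /Sk big_ord1.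
  have sE : Q (run q U eta0 s) <-> Q (run q U eta0 s').
    rewrite hloc; last by move=> p ps; split; exact: noempty.
    rewrite (hloc s'); last first.
      by move=> p; rewrite mem_filter => /andP[_ ps]; split; exact: noempty.
    rewrite /s' -filter_predI.
    rewrite (@eq_filter _ (predI _ _) (fun p => block bl br p.1)) // => p /=.
    by rewrite /block; lia.
  split.
    move=> [s0 [h0 h]]; exists s'; split=> //; apply/sE.
    by rewrite (listing_uniq hs h0).
  move=> [s0 [h0 h]]; exists s; split=> //; apply/sE.
  by rewrite (listing_uniq hs' h0).
split.
  by move=> [M0 h]; apply/(stable (maxn M0 n)); [exact: leq_maxr|apply: h; exact: leq_maxl].
by move=> h; exists n => M nM; apply/(stable M nM).
Qed.

Section Block.
Variables (q : R) (U : int -> nat -> R) (bl br : int).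
Hypothesis blr : bl < br.

Lemma W_step_block c z eta eta' : z != bl -> z != br ->
  {in block bl br, eta =1 eta'} ->
  {in block bl br, W_step c z eta =1
     (if block bl br z then W_step c z eta' else eta')}.
Proof.
move=> zl zr h y yB; have yB' : block bl br y := yB; have [zB|zB] := ifPn.
  have zB' : block bl br (z + 1) by move: zB zr; rewrite /block; lia.
  rewrite /W_step (h z) ?(h (z + 1)) //; case: ifP => _; last exact: h.
  by rewrite /swap_at; case: ifP => _; [exact: h|case: ifP => _; exact: h].
rewrite -(h y yB) /W_step; case: ifP => // _; rewrite /swap_at.
have yz : y != z by apply: contraNneq zB => <-.
have yz1 : y != z + 1.
  by apply: contraNneq zB => e; move: yB' zl zr; rewrite e /block; lia.
by rewrite (negbTE yz) (negbTE yz1).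
Qed.

Lemma run_block s eta eta' : (forall p, p \in s -> p.1 != bl /\ p.1 != br) ->
  {in block bl br, eta =1 eta'} ->
  {in block bl br, run q U eta s =1
     run q U eta' [seq p <- s | block bl br p.1]}.
Proof.
elim: s eta eta' => [|p s IH] eta eta' hs h //=.
have [pl pr'] := hs p (mem_head _ _).
have hs' p' : p' \in s -> p'.1 != bl /\ p'.1 != br.
  by move=> p's; apply: hs; rewrite inE p's orbT.
have := W_step_block (U p.1 p.2 < q) pl pr' h.
by case: ifP => _ h'; exact: IH.
Qed.

Lemma run_no_two s eta : (forall p, p \in s -> p.1 != bl /\ p.1 != br) ->
  (forall y, ~~ block bl br y -> eta y != Some 2%Z) ->
  (forall y, ~~ block bl br y -> run q U eta s y != Some 2%Z).
Proof.
elim: s eta => [|p s IH] eta hs h //=.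
have [pl pr'] := hs p (mem_head _ _).
have hs' p' : p' \in s -> p'.1 != bl /\ p'.1 != br.
  by move=> p's; apply: hs; rewrite inE p's orbT.
apply: IH => // y yB; rewrite /W_step; case: ifP => _; last exact: h.
have zB : ~~ block bl br p.1 -> ~~ block bl br (p.1 + 1).
  by move: pl; rewrite /block; lia.
have zB' : ~~ block bl br (p.1 + 1) -> ~~ block bl br p.1.
  by move: pr'; rewrite /block; lia.
rewrite /swap_at; case: ifPn => [/eqP e|_].
  by apply/h/zB; rewrite -e.
by case: ifPn => [/eqP e|_]; apply: h => //; apply: zB'; rewrite -e.
Qed.

Lemma local_three (x : R) : bl < 0 -> 0 <= br ->
  local_at q U eta0_three (fun eta => exists z : int, eta z = Some 2%Z /\ z%:~R <= x)
    bl br.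
Proof.
move=> bl0 br0 s hs; set s' := [seq p <- s | _].
have hs' p : p \in s' -> p.1 != bl /\ p.1 != br.
  by rewrite mem_filter => /andP[_ /hs].
have no2 y : ~~ block bl br y -> eta0_three y != Some 2%Z.
  rewrite /eta0_three; case: ifP => // _; case: ifPn => // /eqP ->.
  by rewrite /block bl0 br0.
have h : {in block bl br, run q U eta0_three s =1 run q U eta0_three s'}.
  exact: run_block.
split=> -[z [hz zx]]; exists z; split=> //.
  have [zB|zB] := boolP (block bl br z); first by rewrite -h.
  by move: (run_no_two hs no2 zB); rewrite hz eqxx.
have [zB|zB] := boolP (block bl br z); first by rewrite h.
by move: (run_no_two hs' no2 zB); rewrite hz eqxx.
Qed.

Lemma local_two (x : R) : bl < 0 -> 0 <= br ->
  local_at q U (eta0_two x) (fun eta => eta 0 = Some 1%Z) bl br.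
Proof.
move=> bl0 br0 s hs; rewrite (run_block hs (fun _ _ => erefl)) //.
by rewrite unfold_in /block bl0 br0.
Qed.

End Block.
End Listings.

(** * Integrated rates *)

Section Intensity.
Variable R : realType.
Local Notation mu := (@lebesgue_measure R).

Lemma measurable_fun_finite (A : set R) (f : R -> R) :
  finite_set A -> measurable_fun A f.
Proof.
move=> fA mA B mB; apply: countable_measurable; first by move=> t; exact: measurable_set1.
by apply: finite_set_countable; apply: finite_setIl.
Qed.

Lemma piecewise_measurable (f : R -> R) (t : R) :
  piecewise_continuous f -> measurable_fun `[0, t] f.
Proof.
move=> /(_ t)[D hD].
pose S : set R := [set` 0 :: t :: D].
have fS : finite_set S by exact: finite_seq.
pose O := `]0, t[%classic `\` S.
have oO : open O.
  rewrite /O setDE; apply: openI; first exact: interval_open.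
  by rewrite openC; apply: compact_closed; [exact: Rhausdorff|exact: finite_compact].
have eO : `[0, t]%classic = O `|` (`[0, t]%classic `&` S).
  apply/seteqP; split=> u /=.
    have [uS|uS] := boolP (u \in 0 :: t :: D); first by right.
    move=> h; left; split; last by exact/negP.
    move: h; rewrite /= !in_itv /= => /andP[h1 h2].
    move: uS; rewrite !inE !negb_or => /and3P[u0 ut _].
    by rewrite !lt_neqAle eq_sym u0 ut h1.
  case=> [[+ _]|[+ _]]; last by [].
  by rewrite /= !in_itv /= => /andP[h1 h2]; rewrite !ltW.
rewrite eO; apply/measurable_funU.
- exact: open_measurable.
- by apply: countable_measurable => //; apply: finite_set_countable; exact: finite_setIr.
split; last by apply: measurable_fun_finite; exact: finite_setIr.
apply: open_continuous_measurable_fun => // u /set_mem[+ /negP uS].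
rewrite /= in_itv /= => h; apply: hD => //; apply: contra uS.
by rewrite !inE => ->; rewrite !orbT.
Qed.

Definition bounded_rate (C : R) (f : R -> R) : Prop :=
  (forall u, 0 <= u -> 0 <= f u <= C) /\ (forall t : R, measurable_fun `[0, t] f).

Lemma bounded_rate_integrable C f t : bounded_rate C f ->
  mu.-integrable `[0, t] (EFin \o f).
Proof.
move=> [hf mf]; apply: measurable_bounded_integrable => //.
  by rewrite /= lebesgue_measure_itv /=; case: ifP => // _; rewrite -EFinB ltry.
  exact: mf.
exists C; split; first exact: num_real.
move=> y Cy u /=; rewrite in_itv /= => /andP[u0 _].
have /andP[h1 h2] := hf u u0.
by rewrite ger0_norm // (le_trans h2) // ltW.
Qed.

Lemma Lam_increment C (r : int -> R -> R) z s t : bounded_rate C (r z) ->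
  0 <= s -> s <= t ->
  Lam r z t - Lam r z s = \int[mu]_(u in `]s, t]) r z u.
Proof.
by move=> hr s0 st; rewrite /Lam Rintegral_itvB //; exact: bounded_rate_integrable hr.
Qed.

Lemma Lam_bounds C (r : int -> R -> R) z s t : bounded_rate C (r z) ->
  0 <= s -> s <= t -> 0 <= Lam r z t - Lam r z s <= C * (t - s).
Proof.
move=> hr s0 st; rewrite (Lam_increment hr) //.
have sub : `]s, t]%classic `<=` `[0, t]%classic.
  by move=> u /=; rewrite !in_itv /= => /andP[h1 ->]; rewrite andbT; lra.
have hb u : u \in `]s, t]%classic -> 0 <= r z u <= C.
  by move=> /set_mem /sub /=; rewrite in_itv /= => /andP[u0 _]; exact: hr.1.
apply/andP; split.
  by apply: Rintegral_ge0 => u /mem_set /hb /andP[].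
have -> : C * (t - s) = \int[mu]_(u in `]s, t]) C.
  rewrite Rintegral_cst //= lebesgue_measure_itv /=.
  case: ifPn => [//|]; rewrite lte_fin -leNgt => ts.
  by rewrite (_ : t = s) ?subrr //; lra.
apply: le_Rintegral => //.
- exact: integrableS (bounded_rate_integrable t hr).
- apply: measurable_bounded_integrable => //.
    by rewrite /= lebesgue_measure_itv /=; case: ifP => // _; rewrite -EFinB ltry.
  exists `|C|; split; first exact: num_real.
  by move=> y Cy u _ /=; exact: ltW.
- by move=> u /mem_set /hb /andP[].
Qed.

Lemma Lam0 (r : int -> R -> R) z : Lam r z 0 = 0.
Proof. by rewrite /Lam set_itv1 Rintegral_set1. Qed.

Definition reflect_at (tau : R) (u : measurableTypeR R) : measurableTypeR R :=
  tau - u.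

Lemma measurable_reflect_at tau : measurable_fun setT (reflect_at tau).
Proof. exact: measurable_funB. Qed.

HB.instance Definition _ tau := isMeasurableFun.Build _ _ _ _ (reflect_at tau)
  (measurable_reflect_at tau).

Lemma lebesgue_measure_reflect (tau : R) (A : set R) : measurable A ->
  pushforward mu (reflect_at tau) A = mu A.
Proof.
move=> mA; apply/esym/lebesgue_measure_unique => //= _ [[a b]] _ <-.
rewrite /pushforward.
have -> : reflect_at tau @^-1` `]a, b]%classic = `[tau - b, tau - a[%classic.
  by apply/seteqP; split=> u /=; rewrite /reflect_at !in_itv /= => /andP[h1 h2];
    apply/andP; split; lra.
rewrite !lebesgue_measure_itv /= !lte_fin.
have -> : (tau - b < tau - a) = (a < b) by apply/idP/idP; lra.
by case: ifP => // _; rewrite -!EFinB; congr EFin; lra.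
Qed.

Lemma Lam_rhat C (r : int -> R -> R) tau z t : bounded_rate C (r z) ->
  0 <= t -> t <= tau ->
  Lam (rhat r tau) z t = Lam r z tau - Lam r z (tau - t).
Proof.
move=> hr t0 tt; rewrite (Lam_increment hr); [|lra|lra].
rewrite Rintegral_itv_obnd_cbnd; last first.
  apply: integrableS (bounded_rate_integrable tau hr) => // u /=.
  by rewrite !in_itv /= => /andP[h1 ->]; rewrite andbT; lra.
rewrite /Lam /Rintegral; congr fine.
have e : (reflect_at tau) @^-1` `[tau - t, tau]%classic = `[0, t]%classic.
  by apply/seteqP; split=> u /=; rewrite /reflect_at !in_itv /= => /andP[h1 h2];
    apply/andP; split; lra.
transitivity (\int[mu]_(u in `[0%R, t]) ((EFin \o r z) \o reflect_at tau) u)%E.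
  apply: eq_integral => u /set_mem /=; rewrite in_itv /= => /andP[u0 ut].
  by rewrite /rhat /= (le_trans ut tt).
rewrite -e -(@ge0_integral_pushforward _ _ _ _ R (reflect_at tau)) //.
- by apply: eq_measure_integral => A mA _; exact: lebesgue_measure_reflect.
- apply/measurable_EFinP; apply: measurable_funS (hr.2 tau) => // u /=.
  by rewrite !in_itv /= => /andP[h1 ->]; rewrite andbT; lra.
- move=> u /set_mem /=; rewrite in_itv /= => /andP[h1 h2].
  by rewrite lee_fin; have /andP[] := hr.1 u (ltac:(lra)).
Qed.

Lemma bounded_rate_rhat C (r : int -> R -> R) tau z : bounded_rate C (r z) ->
  bounded_rate C (rhat r tau z).
Proof.
move=> hr; have C0 : 0 <= C by have /andP[] := hr.1 0 (lexx 0); exact: le_trans.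
split=> [u u0|t].
  by rewrite /rhat; case: ifP => ut; [apply: hr.1; lra|rewrite lexx].
apply: measurable_fun_if => //.
- by apply: measurable_fun_ler => //; exact: measurable_cst.
- apply: (@measurable_funS _ _ _ _ `[0, tau]%classic) => //.
    by move=> u /= []; rewrite !in_itv /= => /andP[-> _] ->.
  apply: (@measurable_comp _ _ _ _ _ _ `[0, tau]%classic) (hr.2 tau) _ => //.
    move=> _ /= [u + <-]; rewrite !in_itv /= => /andP[h1 h2].
    by apply/andP; split; lra.
  exact: measurable_funB.
Qed.

End Intensity.

(** * Patterns and words *)

Section ProbabilityComplements.
Context d (T : measurableType d) (R : realType) (P : probability T R).
Local Notation pr := (pr P).

Lemma pr_subadd A B : measurable A -> measurable B -> pr (A `|` B) <= pr A + pr B.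
Proof.
move=> mA mB; have mAB := measurableU _ _ mA mB.
rewrite (prIC P mAB mB) addrC; apply: lerD.
  apply: pr_le => // [|w /= [[|]]//].
  by apply: measurableI => //; exact: measurableC.
by apply: pr_le; [exact: measurableI| |move=> w /= []].
Qed.

Lemma pr_setI1 A B : measurable A -> measurable B -> pr B = 1 -> pr (A `&` B) = pr A.
Proof.
move=> mA mB B1; rewrite (prIC P mA mB).
suff -> : pr (A `&` ~` B) = 0 by rewrite addr0.
apply/eqP; rewrite eq_le pr_ge0 andbT.
have mC := measurableC mB.
have <- : pr (~` B) = 0 by rewrite prC // B1 subrr.
by apply: pr_le; [exact: measurableI| |move=> w /= []].
Qed.

Lemma pr_bigcap1 (U : countType) (F : U -> set T) :
  (forall i, measurable (F i)) -> (forall i, pr (F i) = 1) ->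
  pr (\bigcap_i F i) = 1.
Proof.
move=> mF F1; have mI : measurable (\bigcap_i F i) by exact: bigcap_measurable_count.
pose G n := if unpickle n is Some i then ~` F i else set0.
have nG n : P.-negligible (G n).
  rewrite /G; case: unpickle => [i|]; last exact: negligible_set0.
  apply/negligibleP; first exact: measurableC.
  by apply: etrans (prE P (measurableC (mF i))) _; rewrite prC // F1 subrr.
have nU : P.-negligible (~` \bigcap_i F i).
  apply: negligibleS (negligible_bigcup nG) => w /=.
  move=> /existsNP[i] /not_implyP[_ h]; exists (pickle i) => //.
  by rewrite /G pickleK.
have {}nU : pr (~` \bigcap_i F i) = 0.
  by rewrite /pr; have -> := measure_negligible (measurableC mI) nU.
by move: nU; rewrite prC //; lra.
Qed.

Lemma pr_disjoint_sum (J : choiceType) (l : seq J) (V : J -> set T) A :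
  measurable A -> (forall j, measurable (V j)) -> uniq l ->
  (forall j k w, V j w -> V k w -> j = k) ->
  \sum_(j <- l) pr (V j `&` A) = pr (\big[setU/set0]_(j <- l) V j `&` A).
Proof.
move=> mA mV ul hV; elim: l ul => [_|j l IH /= /andP[jl ul]].
  by rewrite !big_nil set0I /pr measure0.
have mB : measurable (\big[setU/set0]_(k <- l) V k) by exact: bigsetU_measurable.
rewrite !big_cons IH // setIUl prU //.
- exact: measurableI.
- exact: measurableI.
- apply/seteqP; split=> w //= [[hj _] [+ _]].
  rewrite -bigcup_seq => -[k /= kl hk].
  by move: jl; rewrite (hV _ _ _ hj hk) kl.
Qed.

Lemma pr_disjoint_sum_le (J : finType) (V : J -> set T) A :
  measurable A -> (forall j, measurable (V j)) ->
  (forall j k w, V j w -> V k w -> j = k) ->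
  \sum_j pr (V j `&` A) <= pr A.
Proof.
move=> mA mV hV; rewrite -big_enum pr_disjoint_sum ?enum_uniq //.
apply: pr_le; [|by []|by move=> w []].
by apply: measurableI => //; exact: bigsetU_measurable.
Qed.

End ProbabilityComplements.

Section PatternWords.
Implicit Types (f : nat -> option int) (n : nat).

Lemma map_fst_points f n : map fst (points f n) = pmap f (iota 0 n).
Proof.
elim: n => [//|n IH]; rewrite -addn1 iotaD pmap_cat /= addn1 /= -IH add0n.
by case: (f n) => [z|] /=; rewrite ?map_rcons ?cats1 ?cats0.
Qed.

Lemma points_lt f n p : p \in points f n -> (p.2 < count_bond f p.1 n)%N.
Proof.
elim: n => [//|n IH] /=; rewrite count_bondS.
case fn: (f n) => [z|]; last by move=> /IH h; rewrite ltn_addr.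
rewrite mem_rcons inE => /orP[/eqP -> /=|/IH h]; first by rewrite eqxx addn1.
by rewrite ltn_addr.
Qed.

Lemma points_uniq f n : uniq (points f n).
Proof.
elim: n => [//|n IH] /=; case: (f n) => [z|] //.
rewrite rcons_uniq IH andbT; apply/negP => /points_lt /=.
by rewrite ltnn.
Qed.

Lemma count_bond_inv f z k n : (k < count_bond f z n)%N ->
  exists i, [/\ (i < n)%N, f i = Some z & count_bond f z i = k].
Proof.
elim: n => [|n IH]; first by rewrite /count_bond big_ord0.
rewrite count_bondS; have [fn|] := eqVneq (f n) (Some z).
  rewrite addn1 ltnS leq_eqVlt => /orP[/eqP ->|/IH[i [h1 h2 h3]]].
    by exists n.
  by exists i; split=> //; apply: ltnW.
by rewrite addn0 => _ /IH[i [h1 h2 h3]]; exists i; split=> //; apply: ltnW.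
Qed.

Lemma pmap_rev (A B : Type) (g : A -> option B) (s : seq A) :
  pmap g (rev s) = rev (pmap g s).
Proof.
elim: s => [//|x s IH]; rewrite rev_cons -cats1 pmap_cat IH /=.
by case: (g x) => [y|] /=; rewrite ?cats0 // rev_cons cats1.
Qed.

Lemma rev_iota0 n : rev (iota 0 n) = [seq (n - i.+1)%N | i <- iota 0 n].
Proof.
apply: (@eq_from_nth _ 0%N); rewrite size_rev size_iota ?size_map ?size_iota // => i hi.
rewrite nth_rev ?size_iota // nth_iota; last by lia.
by rewrite (nth_map 0%N) ?size_iota // nth_iota // add0n.
Qed.

Variables (N M : nat).

Definition bond (b : 'I_M.*2.+1) : int := b%:Z - M%:Z.

Lemma bond_inj : injective bond.
Proof. by move=> b b' /addIr [] h; apply: val_inj. Qed.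

Lemma bondP z : reflect (exists b, z = bond b) (`|z| <= M%:Z).
Proof.
apply: (iffP idP) => [zM|[b ->]]; last first.
  by rewrite /bond; have := ltn_ord b; lia.
have h : (absz (z + M%:Z)%R < M.*2.+1)%N by lia.
by exists (Ordinal h); rewrite /bond /=; lia.
Qed.

Definition pattern := {ffun 'I_N.+1 -> option 'I_M.*2.+1}.

Definition column (F : pattern) (i : nat) : option int :=
  if insub i is Some j then omap bond (F j) else None.

Lemma column_ord F (j : 'I_N.+1) : column F j = omap bond (F j).
Proof. by rewrite /column valK. Qed.

Lemma column_bond F i z : column F i = Some z -> `|z| <= M%:Z.
Proof.
rewrite /column; case: insubP => // j _ _; case: (F j) => //= b [<-].
by apply/bondP; exists b.
Qed.

Lemma column_inj F F' : (forall i, (i < N.+1)%N -> column F i = column F' i) -> F = F'.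
Proof.
move=> h; apply/ffunP => j; have := h j (ltn_ord j); rewrite !column_ord.
case: (F j) => [b|]; case: (F' j) => [b'|] //= /Some_inj e.
by congr Some; apply: bond_inj.
Qed.

Definition rev_pattern (F : pattern) : pattern := [ffun j => F (rev_ord j)].

Lemma rev_patternK : involutive rev_pattern.
Proof. by move=> F; apply/ffunP => j; rewrite !ffunE rev_ordK. Qed.

Definition word (F : pattern) : seq int := pmap (column F) (iota 0 N.+1).

Lemma word_rev F : word (rev_pattern F) = rev (word F).
Proof.
rewrite /word -pmap_rev rev_iota0.
have : {subset iota 0 N.+1 <= gtn N.+1} by move=> i; rewrite mem_iota.
elim: (iota 0 N.+1) => [//|i s IH] hs; rewrite /= IH => [|j js]; last first.
  by apply: hs; rewrite inE js orbT.
have iN : (i < N.+1)%N by apply: hs; rewrite mem_head.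
suff -> : column (rev_pattern F) i = column F (N.+1 - i.+1) by [].
rewrite -[i]/(val (Ordinal iN)) column_ord ffunE.
by rewrite -[(N.+1 - _)%N]/(val (rev_ord (Ordinal iN))) column_ord.
Qed.

End PatternWords.

(** * Pattern expansion of the process *)

Section Process.
Context d (T : measurableType d) (R : realType) (P : probability T R).
Context (X : int * nat * bool -> T -> R) (hX : clock_family P X).
Variables (q C tau : R) (r : int -> R -> R).
Hypothesis hq : 0 <= q <= 1.
Hypothesis hr : forall z, bounded_rate C (r z).
Hypothesis tau0 : 0 <= tau.
Local Notation pr := (pr P).

Let indX : mutually_independent P X := hX.1.

Lemma Lam_monotone z s t : 0 <= s -> s <= t -> Lam r z s <= Lam r z t.
Proof. by move=> s0 st; have /andP[] := Lam_bounds (hr z) s0 st; lra. Qed.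

Lemma rate_bound_ge0 : 0 <= C.
Proof. by have /andP[h1 h2] := (hr 0).1 0 (lexx 0); exact: le_trans h2. Qed.

Lemma measurable_Sk_le z k x : measurable [set w | Sk (Efam X w) z k <= x].
Proof.
rewrite (_ : [set w | _] = ~` [set w | x < Sk (Efam X w) z k]).
  apply: measurableC; apply: (sigX_measurable indX (K := setT)).
  by apply: sig_gt; exact: sig_point_time.
by apply/seteqP; split=> w /=; rewrite leNgt => /negP.
Qed.

(* Continuity of [Lam] lets the time in [before] be taken rational. *)
Lemma measurable_before p p' : measurable [set w | before r (Efam X w) p p'].
Proof.
pose F (u : rat) := [set w | Sk (Efam X w) p.1 p.2 <= Lam r p.1 (ratr u)] `&`
  ~` [set w | Sk (Efam X w) p'.1 p'.2 <= Lam r p'.1 (ratr u)].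
have -> : [set w | before r (Efam X w) p p'] = \bigcup_(u in [set u : rat | 0 <= u]) F u.
  apply/seteqP; split=> w /=; last first.
    move=> [u /= u0 [h1 h2]]; exists (ratr u); split; first by rewrite ler0q.
    by split=> //; rewrite ltNge; apply/negP.
  move=> [t [t0 [h1 h2]]].
  set x := Sk (Efam X w) p'.1 p'.2 in h2 *.
  have C1 : 0 < C + 1 by have := rate_bound_ge0; lra.
  have tt : t < t + (x - Lam r p'.1 t) / (C + 1).
    by rewrite ltrDl divr_gt0 // subr_gt0.
  have [u] := rat_in_itvoo tt; rewrite in_itv /= => /andP[tu ut].
  exists u => /=; first by rewrite -(ler0q R); lra.
  split=> /=; first by apply: (le_trans h1); apply: Lam_monotone => //; exact: ltW.
  apply/negP; rewrite -ltNge -/x.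
  have /andP[_ h3] := Lam_bounds (hr p'.1) t0 (ltW tu).
  have h4 : (ratr u - t) * (C + 1) < x - Lam r p'.1 t by rewrite -ltr_pdivlMr //; lra.
  have := rate_bound_ge0; nra.
apply: bigcup_measurable_count => u _; apply: measurableI; first exact: measurable_Sk_le.
by apply: measurableC; exact: measurable_Sk_le.
Qed.

Lemma measurable_listing M t s : measurable [set w | listing r (Efam X w) M t s].
Proof.
have [us|us] := boolP (uniq s); last first.
  rewrite (_ : [set w | _] = set0) //.
  by apply/seteqP; split=> w //= [h]; rewrite h in us.
pose F (p : int * nat) := [set w | p \in s <->
  ((`|p.1| <= M%:Z)%R /\ Sk (Efam X w) p.1 p.2 <= Lam r p.1 t)].
have -> : [set w | listing r (Efam X w) M t s] = \bigcap_p F p `&`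
    [set w | sorted (fun a b => `[< before r (Efam X w) a b >]) s].
  apply/seteqP; split=> w /=; first by move=> [_ [h1 h2]]; split=> // p _; exact: h1.
  by move=> [h1 h2]; split=> //; split=> // p; exact: (h1 p I).
apply: measurableI.
  apply: bigcap_measurable_count => p _; rewrite /F.
  have mS := measurable_Sk_le p.1 p.2 (Lam r p.1 t).
  have [ps|ps] := boolP (p \in s); have [pM|pM] := boolP (`|p.1| <= M%:Z)%R.
  - rewrite (_ : [set w | _] = [set w | Sk (Efam X w) p.1 p.2 <= Lam r p.1 t]) //.
    apply/seteqP; split=> w /=; first by move=> [/(_ isT)[]].
    by move=> h; split.
  - rewrite (_ : [set w | _] = set0) //; apply/seteqP; split=> w //=.
    by move=> [/(_ isT)[]].
  - rewrite (_ : [set w | _] = ~` [set w | Sk (Efam X w) p.1 p.2 <= Lam r p.1 t]).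
      exact: measurableC.
    apply/seteqP; split=> w /=; first by move=> [_ h] h'; have := h (conj isT h').
    by move=> h; split=> // -[_ /h].
  - rewrite (_ : [set w | _] = setT) //; apply/seteqP; split=> w //= _.
    by split=> // -[].
case: s {us F} => [|p s] /=; first by rewrite (_ : [set w | _] = setT) //; apply/seteqP.
elim: s p => [|p' s IH] p /=; first by rewrite (_ : [set w | _] = setT) //; apply/seteqP.
rewrite (_ : [set w | _] = [set w | before r (Efam X w) p p'] `&`
  [set w | path (fun a b => `[< before r (Efam X w) a b >]) p' s]).
  by apply: measurableI => //; exact: measurable_before.
apply/seteqP; split=> w /=; first by move=> /andP[/asboolP].
by move=> [h1 ->]; rewrite andbT; apply/asboolP.
Qed.

Section Event.
Variables (eta0 : config) (Q : config -> Prop).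

Definition asep_at_set M : set T :=
  [set w | asep_at r (Efam X w) q eta0 tau (Ufam X w) Q M].

Definition asep_set : set T :=
  [set w | asep_event r q eta0 tau (Efam X w) (Ufam X w) Q].

Lemma measurable_asep_at M : measurable (asep_at_set M).
Proof.
rewrite (_ : asep_at_set M = \bigcup_(s in [set: seq (int * nat)])
  ([set w | listing r (Efam X w) M tau s] `&`
   [set w | Q (run q (Ufam X w) eta0 s)])).
  apply: bigcup_measurable_count => s _; apply: measurableI.
    exact: measurable_listing.
  exact: (measurable_run hX).
by apply/seteqP; split=> w /= [s]; [exists s|move=> _ ?; exists s].
Qed.

Lemma measurable_asep_event : measurable asep_set.
Proof.
rewrite (_ : asep_set = \bigcup_(M0 in [set: nat])
    \bigcap_(M in [set M | (M0 <= M)%N]) asep_at_set M).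
  apply: bigcup_measurable_count => M0 _; apply: bigcap_measurable_count => M _.
  exact: measurable_asep_at.
by apply/seteqP; split=> w /= [M0]; [exists M0|move=> _ ?; exists M0].
Qed.

End Event.

Definition positive : set T :=
  \bigcap_(p in [set: int * nat]) [set w | 0 < X (p, false) w].

Lemma measurable_positive : measurable positive.
Proof.
apply: bigcap_measurable_count => p _; apply: (sigX_measurable indX (K := setT)).
by apply: sig_gt; exact: sig_funX.
Qed.

Lemma pr_positive : pr positive = 1.
Proof.
apply: pr_bigcap1 => [p|[z k]].
  by apply: (sigX_measurable indX (K := setT)); apply: sig_gt; exact: sig_funX.
have := @indep_gt _ _ _ _ _ _ indX set0 (z, k, false) setT 0
  (fun h => h) (expX hX z k) (lexx 0) (@sigX_setT _ _ _ _ X set0).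
by rewrite setTI prT oppr0 expR0 mul1r.
Qed.

Section Pattern.
Variables (N M : nat).

Definition step_time (z : int) (i : nat) : R := Lam r z (grid 0 tau N i).

Lemma step_time0 z : step_time z 0 = 0.
Proof. by rewrite /step_time grid0 Lam0. Qed.

Lemma step_timeN z : step_time z N.+1 = Lam r z tau.
Proof. by rewrite /step_time gridn. Qed.

Lemma step_time_mono z i : step_time z i <= step_time z i.+1.
Proof.
by apply: Lam_monotone; rewrite ?grid_mono // -{1}(grid0 0 tau N) grid_mono.
Qed.

Definition pattern_set (F : pattern N M) : set T :=
  (in_cells X step_time (column F) N.+1 `&` no_more X step_time N.+1 M (column F) N.+1)
  `&` positive.

Definition pattern_weight (F : pattern N M) : R :=
  \prod_(i < N.+1) weight step_time (column F i) i.

Definition no_point : R := \prod_(b < M.*2.+1) expR (- Lam r (bond b) tau).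

Let clocks : set (int * nat * bool) := [set j | j.2 = false].

Lemma sig_cells (F : pattern N M) : sigX X clocks
  (in_cells X step_time (column F) N.+1 `&` no_more X step_time N.+1 M (column F) N.+1).
Proof.
apply: sigX_setI; first exact: sig_in_cells.
by apply: sig_bigcap => z _; apply: sig_gt; exact: sig_point_time.
Qed.

Lemma measurable_cells (F : pattern N M) : measurable
  (in_cells X step_time (column F) N.+1 `&` no_more X step_time N.+1 M (column F) N.+1).
Proof. exact: (sigX_measurable indX (sig_cells F)). Qed.

Lemma measurable_pattern_set F : measurable (pattern_set F).
Proof.
by apply: measurableI; [exact: measurable_cells|exact: measurable_positive].
Qed.

Lemma pr_no_more f : pr (no_more X step_time N.+1 M f 0) = no_point.
Proof.
have -> : no_more X step_time N.+1 M f 0 =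
    \bigcap_(z in [set` [seq bond b | b <- enum 'I_M.*2.+1]])
      (X (z, 0%N, false) @^-1` `]Lam r z tau, +oo[%classic).
  have pE z w : point_time X z 0 w = X (z, 0%N, false) w.
    by rewrite /point_time /Sk big_ord1.
  have cE z : count_bond f z 0 = 0%N by rewrite /count_bond big_ord0.
  apply/seteqP; split=> w h z.
    move=> /= /mapP[b _ zb]; rewrite in_itv /= andbT -step_timeN -pE -(cE z).
    by apply: h; apply/bondP; exists b.
  move=> /bondP[b zb]; rewrite /= cE pE step_timeN.
  have := h z; rewrite /= in_itv /= andbT; apply.
  by rewrite zb map_f // mem_enum.
rewrite (pr_bigcap hX); last 1 first.
- by move=> z; exact: measurable_itv.
- rewrite big_map big_enum /=; apply: eq_bigr => b _.
  have := @indep_gt _ _ _ _ _ _ indX set0 (bond b, 0%N, false) setT (Lam r (bond b) tau)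
    (fun h => h) (expX hX _ _) _ (@sigX_setT _ _ _ _ X set0).
  rewrite setTI prT mul1r => <-; last by rewrite -(Lam0 r (bond b)); exact: Lam_monotone.
  by congr pr; apply/seteqP; split=> w /=; rewrite in_itv /= andbT.
- by rewrite map_inj_uniq ?enum_uniq //; exact: bond_inj.
Qed.

Lemma pr_cells_run F Q eta0 :
  pr (pattern_set F `&` [set w | Q (run q (Ufam X w) eta0 (points (column F) N.+1))]) =
  no_point * pattern_weight F * coin_avg q Q eta0 (word F).
Proof.
have mR := measurable_run hX q Q eta0 (points (column F) N.+1).
rewrite /pattern_set setIAC pr_setI1; last 1 first.
- exact: pr_positive.
- rewrite (pr_run hX Q eta0 hq (sig_cells F) (points_uniq _ _)) => [|p _]; last by [].
  rewrite map_fst_points (pr_pattern hX step_time0 step_time_mono (leqnn _)).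
    by rewrite pr_no_more.
  by move=> i z _; exact: column_bond.
- by apply: measurableI => //; exact: measurable_cells.
- exact: measurable_positive.
Qed.

Lemma pr_pattern_set F : pr (pattern_set F) = no_point * pattern_weight F.
Proof.
rewrite pr_setI1; [|exact: measurable_cells|exact: measurable_positive|exact: pr_positive].
rewrite (pr_pattern hX step_time0 step_time_mono (leqnn _)) ?pr_no_more //.
by move=> i z _; exact: column_bond.
Qed.

Lemma in_cellsP f n w i z : in_cells X step_time f n w -> (i < n)%N -> f i = Some z ->
  step_time z i < Sk (Efam X w) z (count_bond f z i) <= step_time z i.+1.
Proof.
elim: n => [//|n IH] /= [h1 h2]; rewrite ltnS leq_eqVlt => /orP[/eqP ->|iN] fi.
  by move: h2; rewrite fi.
exact: IH.
Qed.

Lemma pattern_listing F w : pattern_set F w ->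
  listing r (Efam X w) M tau (points (column F) N.+1).
Proof.
move=> [[h1 h2] h3]; apply: points_listing => //.
- exact: Lam_monotone.
- by move=> z k; exact: (h3 (z, k)).
- move=> i z iN fi; split; first exact: column_bond fi.
  exact: in_cellsP h1 iN fi.
Qed.

Lemma pattern_inj F F' w : pattern_set F w -> pattern_set F' w -> F = F'.
Proof.
have main (G G' : pattern N M) i z : pattern_set G w -> pattern_set G' w ->
    (i < N.+1)%N -> column G i = Some z -> column G' i = Some z.
  move=> [[h1 _] pos] [[h1' h2'] _] iN Gi.
  have /andP[l u] := in_cellsP h1 iN Gi.
  set k := count_bond _ _ _ in l u.
  have kN : (k < count_bond (column G') z N.+1)%N.
    rewrite ltnNge; apply/negP => kN.
    have E0 y m : 0 < Efam X w y m by exact: (pos (y, m)).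
    have := Sk_le E0 z kN; have := h2' z (column_bond Gi) => /= h3 h4.
    have : step_time z i.+1 <= step_time z N.+1 by apply: (a_le step_time_mono).
    by rewrite /point_time in h3; lra.
  have [j [jN Gj kE]] := count_bond_inv kN.
  have /andP[l' u'] := in_cellsP h1' jN Gj; rewrite kE in l' u'.
  case: (ltngtP i j) => [ij|ji|ij]; last by rewrite ij.
    by have := lt_le_trans l' (le_trans u (a_le step_time_mono z ij)); rewrite ltxx.
  by have := lt_le_trans l (le_trans u' (a_le step_time_mono z ji)); rewrite ltxx.
move=> hF hF'; apply: column_inj => i iN.
case e: (column F i) => [z|]; first by rewrite (main F F' i z).
by case e': (column F' i) => [z|//]; rewrite (main F' F i z) in e.
Qed.

Lemma sum_pattern_le A : measurable A -> \sum_F pr (pattern_set F `&` A) <= pr A.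
Proof.
move=> mA; apply: pr_disjoint_sum_le => // [F|F F' w].
  exact: measurable_pattern_set.
exact: pattern_inj.
Qed.

Lemma asep_at_pattern F eta0 Q :
  pattern_set F `&` asep_at_set eta0 Q M =
  pattern_set F `&` [set w | Q (run q (Ufam X w) eta0 (points (column F) N.+1))].
Proof.
apply/seteqP; split=> w [hF h]; split=> //; last first.
  by exists (points (column F) N.+1); split=> //; exact: pattern_listing.
case: h => s [hs Qs].
by rewrite (listing_uniq Lam_monotone hs (pattern_listing hF)) in Qs.
Qed.

Definition sum_weights (Q : config -> Prop) (eta0 : config) : R :=
  \sum_(F : pattern N M) no_point * pattern_weight F * coin_avg q Q eta0 (word F).

Definition covered : R := \sum_(F : pattern N M) no_point * pattern_weight F.

Lemma pr_asep_at_bounds eta0 Q :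
  sum_weights Q eta0 <= pr (asep_at_set eta0 Q M) <= sum_weights Q eta0 + (1 - covered).
Proof.
have mA := measurable_asep_at eta0 Q M.
have sE : sum_weights Q eta0 = \sum_F pr (pattern_set F `&` asep_at_set eta0 Q M).
  by apply: eq_bigr => F _; rewrite asep_at_pattern pr_cells_run.
have := sum_pattern_le (measurableC mA); rewrite prC // => hC.
have cE : covered = sum_weights Q eta0 +
    \sum_F pr (pattern_set F `&` ~` asep_at_set eta0 Q M).
  rewrite sE -big_split; apply: eq_bigr => F _ /=.
  by rewrite -prIC ?pr_pattern_set //; exact: measurable_pattern_set.
by rewrite {1}sE sum_pattern_le //=; lra.
Qed.

Lemma pr_listing_ge : covered <= pr [set w | exists s, listing r (Efam X w) M tau s].
Proof.
set A := [set w | _]; have mA : measurable A.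
  rewrite (_ : A = \bigcup_(s in [set: seq (int * nat)])
    [set w | listing r (Efam X w) M tau s]).
    by apply: bigcup_measurable_count => s _; exact: measurable_listing.
  by apply/seteqP; split=> w /= [s]; [exists s|move=> _ ?; exists s].
apply: le_trans (sum_pattern_le mA); apply: ler_sum => F _.
rewrite -pr_pattern_set (_ : _ `&` A = pattern_set F) //.
apply/seteqP; split=> w; first by case.
by move=> h; split=> //; exists (points (column F) N.+1); exact: pattern_listing.
Qed.

End Pattern.
End Process.

(** * Coverage, reversal, and stabilisation *)

Section Coverage.
Variable R : realType.

Lemma prod_ge_sub (n : nat) (y e : nat -> R) :
  (forall i, 0 <= y i <= 1) -> (forall i, 0 <= e i) -> (forall i, 1 - e i <= y i) ->
  1 - \sum_(i < n) e i <= \prod_(i < n) y i.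
Proof.
move=> hy he hye; elim: n => [|n IH]; first by rewrite !big_ord0 subr0.
rewrite !big_ord_recr /=.
have p0 : 0 <= \prod_(i < n) y i by apply: prodr_ge0 => i _; have /andP[] := hy i.
have p1 : \prod_(i < n) y i <= 1 by apply: prodr_ile1 => i _; exact: hy.
have := hye n; have := he n; have /andP[] := hy n; move: p0 p1 IH.
by move: (\prod_(i < n) y i) (\sum_(i < n) e i) (y n) (e n) => p s u v; nra.
Qed.

Lemma big_option (A : finType) (h : option A -> R) :
  \sum_o h o = h None + \sum_a h (Some a).
Proof.
rewrite (bigD1 None) //=; congr (_ + _).
rewrite (reindex_omap Some id) /=; last by case.
by apply: eq_bigl => a; rewrite eqxx.
Qed.

Variables (C tau : R) (r : int -> R -> R).
Hypothesis hr : forall z, bounded_rate C (r z).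
Hypothesis tau0 : 0 <= tau.

Let increment N M i : R :=
  \sum_(b < M.*2.+1) (step_time tau r N (bond b) i.+1 - step_time tau r N (bond b) i).

Lemma covered_prod N M : covered tau r N M =
  \prod_(i < N.+1) (expR (- increment N M i) * (1 + increment N M i)).
Proof.
rewrite /covered -mulr_sumr big_split /=; congr (_ * _).
  rewrite /no_point -!expR_sum; congr expR; rewrite !sumrN; congr (- _).
  rewrite /increment exchange_big /=; apply: eq_bigr => b _.
  rewrite -(big_mkord xpredT
    (fun i => step_time tau r N (bond b) i.+1 - step_time tau r N (bond b) i)).
  by rewrite telescope_sumr // step_timeN step_time0 subr0.
pose g (i : 'I_N.+1) (o : option 'I_M.*2.+1) := weight (step_time tau r N) (omap (@bond M) o) i.
transitivity (\sum_(F : pattern N M) \prod_i g i (F i)).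
  by apply: eq_bigr => F _; apply: eq_bigr => i _; rewrite column_ord.
by rewrite -bigA_distr_bigA; apply: eq_bigr => i _; rewrite big_option.
Qed.

Lemma covered_ge N M :
  1 - ((M.*2.+1)%:R * C * tau) ^+ 2 / N.+1%:R <= covered tau r N M.
Proof.
rewrite covered_prod.
set k := _ * tau.
have x0 i : 0 <= increment N M i.
  apply: sumr_ge0 => b _; rewrite subr_ge0; exact: (step_time_mono hr).
have xk i : increment N M i <= k / N.+1%:R.
  rewrite (_ : k / _ = \sum_(b < M.*2.+1) C * (tau / N.+1%:R)); last first.
    by rewrite sumr_const card_ord /k -[RHS]mulr_natl; ring.
  apply: ler_sum => b _; rewrite /step_time.
  have g0 : 0 <= grid 0 tau N i by rewrite -{1}(grid0 0 tau N) grid_mono.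
  have /andP[_] := Lam_bounds (hr (bond b)) g0 (grid_mono N tau0 (leqnSn i)).
  by rewrite gridS subr0 [grid _ _ _ _ + _ - _]addrC addKr.
pose e (_ : nat) := (k / N.+1%:R) ^+ 2.
have eE : k ^+ 2 / N.+1%:R = \sum_(i < N.+1) e i.
  rewrite sumr_const card_ord -[RHS]mulr_natl /e expr_div_n [N.+1%:R ^+ 2]expr2.
  have : N.+1%:R != 0 :> R by rewrite pnatr_eq0.
  by move: N.+1%:R => u u0; field.
rewrite eE; apply: (@prod_ge_sub _ (fun i => expR (- increment N M i) * (1 + increment N M i))).
- move=> i; rewrite mulr_ge0 ?expR_ge0 //=; last by have := x0 i; lra.
  have := expR_ge1Dx (increment N M i); have := expRxMexpNx_1 (increment N M i).
  by have := expR_gt0 (- increment N M i); nra.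
- by move=> i; exact: sqr_ge0.
- move=> i; rewrite /e.
  have := x0 i; have := xk i; have := expR_ge1Dx (- increment N M i).
  move: (increment N M i) (expR _) (k / _) => x E u h1 h2 h3.
  have h4 : (1 + x) * (1 - x) <= (1 + x) * E by rewrite ler_wpM2l //; lra.
  have h5 : x ^+ 2 <= u ^+ 2 by rewrite lerXn2r ?nnegrE //; lra.
  by rewrite !expr2 in h5 *; lra.
Qed.

End Coverage.

Section Reversal.
Variables (R : realType) (C tau : R) (r : int -> R -> R).
Hypothesis hr : forall z, bounded_rate C (r z).
Hypothesis tau0 : 0 <= tau.
Variables (N M : nat).

Lemma step_time_rhat z i : (i <= N.+1)%N ->
  step_time tau (rhat r tau) N z i =
  Lam r z tau - step_time tau r N z (N.+1 - i).
Proof.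
move=> iN; rewrite /step_time (Lam_rhat (hr z)).
- congr (_ - Lam r z _); rewrite /grid natrB // subr0 !add0r.
  have : N.+1%:R != 0 :> R by rewrite pnatr_eq0.
  by move: N.+1%:R => u u0; field.
- by rewrite -{1}(grid0 0 tau N) grid_mono.
- by rewrite -[leRHS](gridn 0 tau N) grid_mono.
Qed.

Lemma no_point_rhat : no_point tau (rhat r tau) M = no_point tau r M.
Proof.
apply: eq_bigr => b _; congr (expR (- _)).
by rewrite (Lam_rhat (hr _)) // subrr Lam0 subr0.
Qed.

Lemma pattern_weight_rev (F : pattern N M) :
  pattern_weight tau (rhat r tau) (rev_pattern F) = pattern_weight tau r F.
Proof.
rewrite /pattern_weight (reindex_inj rev_ord_inj) /=; apply: eq_bigr => j _.
rewrite -[(N.+1 - j.+1)%N]/(val (rev_ord j)) !column_ord ffunE rev_ordK.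
case: (F j) => //= b; have jN := ltn_ord j.
rewrite !step_time_rhat; try by lia.
have -> : (N.+1 - (N.+1 - j.+1).+1 = j)%N by lia.
have -> : (N.+1 - (N.+1 - j.+1) = j.+1)%N by lia.
by ring.
Qed.

Lemma sum_weights_rhat (q x : R) :
  sum_weights q tau r N M
    (fun eta => exists z : int, eta z = Some 2%Z /\ z%:~R <= x) eta0_three =
  sum_weights q tau (rhat r tau) N M (fun eta => eta 0 = Some 1%Z) (eta0_two x).
Proof.
rewrite /sum_weights [RHS](reindex_inj (inv_inj (@rev_patternK N M))) /=.
apply: eq_bigr => F _.
by rewrite no_point_rhat pattern_weight_rev word_rev coin_avg_rev.
Qed.

End Reversal.

Section Stabilisation.
Context d (T : measurableType d) (R : realType) (P : probability T R).
Context (X : int * nat * bool -> T -> R) (hX : clock_family P X).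
Variables (q C tau : R) (r : int -> R -> R).
Hypothesis hr : forall z, bounded_rate C (r z).
Hypothesis tau0 : 0 <= tau.
Local Notation pr := (pr P).

Let listed M : set T := [set w | exists s, listing r (Efam X w) M tau s].

Lemma measurable_listed M : measurable (listed M).
Proof.
rewrite (_ : listed M = \bigcup_(s in [set: seq (int * nat)])
  [set w | listing r (Efam X w) M tau s]).
  by apply: bigcup_measurable_count => s _; exact: (measurable_listing hX hr).
by apply/seteqP; split=> w /= [s]; [exists s|move=> _ ?; exists s].
Qed.

Lemma pr_listed M : pr (listed M) = 1.
Proof.
apply/eqP; rewrite eq_le pr_le1 /=; last exact: measurable_listed.
apply: (@le_of_inv_nat _ _ _ (((M.*2.+1)%:R * C * tau) ^+ 2)) => N.
rewrite -lerBlDr; apply: le_trans (covered_ge hr tau0 N M) _.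
exact: pr_listing_ge.
Qed.

Let busy (l : seq int) : set T :=
  \bigcap_(z in [set` l]) (X (z, 0%N, false) @^-1` `]-oo, Lam r z tau]%classic).

Lemma measurable_busy l : measurable (busy l).
Proof.
by apply: bigcap_measurable_count => z _; exact: (measurable_preX hX.1).
Qed.

Lemma pr_busy_le l : uniq l -> pr (busy l) <= (1 - expR (- (C * tau))) ^+ size l.
Proof.
move=> ul; rewrite (pr_bigcap hX ul); last by move=> z; exact: measurable_itv.
have hz z : 0 <= pr (X (z, 0%N, false) @^-1` `]-oo, Lam r z tau]%classic)
    <= 1 - expR (- (C * tau)).
  rewrite pr_ge0 /=.
  have L0 : 0 <= Lam r z tau by rewrite -(Lam0 r z); exact: (Lam_monotone hr).
  have LC : Lam r z tau <= C * tau.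
    by have /andP[_] := Lam_bounds (hr z) (lexx 0) tau0; rewrite Lam0 !subr0.
  have -> : X (z, 0%N, false) @^-1` `]-oo, Lam r z tau]%classic =
      [set w | X (z, 0%N, false) w <= Lam r z tau].
    by apply/seteqP; split=> w /=; rewrite in_itv.
  by rewrite /pr (expX hX z 0) L0 /= lerD2l lerN2 ler_expR lerN2.
elim: l {ul} => [|z l IH]; first by rewrite big_nil expr0.
rewrite big_cons exprS; have /andP[h1 h2] := hz z; apply: ler_pM => //.
by apply: prodr_ge0 => y _; have /andP[] := hz y.
Qed.

Variables (eta0 : config) (Q : config -> Prop).
Hypothesis hloc : forall w bl br, bl < 0 -> 0 <= br ->
  local_at q (Ufam X w) eta0 Q bl br.

Lemma asep_event_approx n :
  `|pr (asep_set X q tau r eta0 Q) - pr (asep_at_set X q tau r eta0 Q n.+1)| <=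
  2 * (1 - expR (- (C * tau))) ^+ n.+1.
Proof.
pose lp := [seq i%:Z | i <- iota 0 n.+1].
pose ln := [seq - i.+1%:Z | i <- iota 0 n.+1].
have up : uniq lp by rewrite map_inj_uniq ?iota_uniq // => i j [].
have un : uniq ln by rewrite map_inj_uniq ?iota_uniq // => i j; lia.
have bp := pr_busy_le up; have bn := pr_busy_le un.
rewrite size_map size_iota in bp; rewrite size_map size_iota in bn.
pose typical := positive X `&` \bigcap_M listed M.
have mlist : measurable (\bigcap_M listed M).
  by apply: bigcap_measurable_count => M _; exact: measurable_listed.
have mpos := measurable_positive hX.
have mtyp : measurable typical by exact: measurableI.
have ptyp : pr typical = 1.
  rewrite pr_setI1 // ?(pr_positive hX) //.
  by apply: pr_bigcap1 => M; [exact: measurable_listed|exact: pr_listed].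
have stable w : typical w -> ~ busy lp w -> ~ busy ln w ->
    asep_set X q tau r eta0 Q w <-> asep_at_set X q tau r eta0 Q n.+1 w.
  have free l : ~ busy l w -> exists2 z, z \in l & Lam r z tau < Efam X w z 0.
    move=> /existsNP[z] /not_implyP[zl] /=; rewrite in_itv /= => /negP.
    by rewrite -ltNge => h; exists z.
  move=> [pos ls] /free[br /mapP[i hi ->] hbr] /free[bl /mapP[j hj ->] hbl].
  rewrite mem_iota in hi; rewrite mem_iota in hj.
  apply: (@asep_event_stable _ _ _ _ _ q eta0 tau (Ufam X w) Q n.+1 (- j.+1%:Z) i%:Z) => //.
  - exact: (Lam_monotone hr).
  - by move=> z k; exact: (pos (z, k)).
  - by move=> M; exact: (ls M I).
  - by apply: hloc; lia.
  - by lia.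
have half A B : measurable A -> measurable B ->
    (forall w, typical w -> ~ busy lp w -> ~ busy ln w -> A w -> B w) ->
    pr A <= pr B + 2 * (1 - expR (- (C * tau))) ^+ n.+1.
  move=> mA mB AB; have mp := measurable_busy lp; have mn := measurable_busy ln.
  have mpn := measurableU _ _ mp mn.
  rewrite -(pr_setI1 mA mtyp ptyp).
  apply: (@le_trans _ _ (pr (B `|` (busy lp `|` busy ln)))).
    apply: pr_le; [exact: measurableI|exact: measurableU|].
    move=> w [Aw tw]; have [h|h] := pselect (busy lp w); first by right; left.
    have [h'|h'] := pselect (busy ln w); first by right; right.
    by left; exact: AB.
  apply: le_trans (pr_subadd P mB mpn) _; rewrite lerD2l.
  by apply: le_trans (pr_subadd P mp mn) _; lra.
have mE := measurable_asep_event hX q tau hr eta0 Q.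
have mM := measurable_asep_at hX q tau hr eta0 Q n.+1.
have h1 := half _ _ mE mM (fun w h h' h'' => (stable w h h' h'').1).
have h2 := half _ _ mM mE (fun w h h' h'' => (stable w h h' h'').2).
by rewrite ler_norml; apply/andP; split; lra.
Qed.

End Stabilisation.

Lemma eq_of_geometric (R : realType) (x y K s : R) : 0 < s -> s <= 1 ->
  (forall n : nat, `|x - y| <= K * (1 - s) ^+ n.+1) -> x = y.
Proof.
move=> s0 s1 h; apply/eqP; rewrite -subr_eq0 -normr_le0.
apply: (@le_of_inv_nat _ _ _ (`|K| / s)) => n; rewrite add0r.
apply: le_trans (h n) _; apply: (@le_trans _ _ (`|K| * (1 - s) ^+ n.+1)).
  by rewrite ler_wpM2r ?ler_norm // exprn_ge0 //; lra.
rewrite -mulrA ler_wpM2l //.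
have n0 : 0 < n.+1%:R :> R by [].
rewrite -invfM -[leRHS]mul1r ler_pdivlMr ?mulr_gt0 //.
apply: (@le_trans _ _ (expR (- s * n.+1%:R) * (s * n.+1%:R))).
  have sn0 : 0 <= s * n.+1%:R by rewrite mulr_ge0 // ltW.
  rewrite ler_wpM2r // expRM_natr.
  by rewrite lerXn2r ?nnegrE ?expR_ge0 //; [lra|exact: expR_ge1Dx].
rewrite mulNr expRN mulrC ler_pdivrMr ?expR_gt0 // mul1r.
by have := expR_ge1Dx (s * n.+1%:R); lra.
Qed.

Theorem theorem4p1 (R : realType) (q C : R) (r : int -> R -> R) (tau x : R)
  (hq : 0 <= q <= 1)
  (hr : forall (z : int) (u : R), 0 <= u -> 0 <= r z u <= C)
  (hpc : forall z : int, piecewise_continuous (r z))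
  (htau : 0 <= tau)
  (d : measure_display) (T : measurableType d) (P : probability T R)
  (X : int * nat * bool -> T -> R) (hX : clock_family P X)
  (d' : measure_display) (T' : measurableType d') (P' : probability T' R)
  (X' : int * nat * bool -> T' -> R) (hX' : clock_family P' X') :
  P [set w | asep_event r q eta0_three tau (Efam X w) (Ufam X w)
               (fun eta => exists z : int, eta z = Some 2%Z /\ z%:~R <= x)]
  = P' [set w | asep_event (rhat r tau) q (eta0_two x) tau (Efam X' w) (Ufam X' w)
               (fun eta => eta 0 = Some 1%Z)].
Proof.
have br z : bounded_rate C (r z).
  by split; [exact: hr|move=> t; exact: piecewise_measurable].
have brh z : bounded_rate C (rhat r tau z) by exact: bounded_rate_rhat.
have C0 := rate_bound_ge0 br.
set Q := (fun eta => exists z : int, _); set Q' := (fun eta => eta 0 = _).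
have eqM M : pr P (asep_at_set X q tau r eta0_three Q M) =
    pr P' (asep_at_set X' q tau (rhat r tau) (eta0_two x) Q' M).
  pose K := ((M.*2.+1)%:R * C * tau) ^+ 2.
  have close N : let a := pr P (asep_at_set X q tau r eta0_three Q M) in
      let b := pr P' (asep_at_set X' q tau (rhat r tau) (eta0_two x) Q' M) in
      (a <= b + K / N.+1%:R) /\ (b <= a + K / N.+1%:R).
    have /andP[h1 h2] := pr_asep_at_bounds hX hq br htau N M eta0_three Q.
    have /andP[h1' h2'] := pr_asep_at_bounds hX' hq brh htau N M (eta0_two x) Q'.
    have eS : sum_weights q tau r N M Q eta0_three =
      sum_weights q tau (rhat r tau) N M Q' (eta0_two x) := sum_weights_rhat br htau N M q x.
    have c1 : 1 - K / N.+1%:R <= covered tau r N M := covered_ge br htau N M.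
    have c2 : 1 - K / N.+1%:R <= covered tau (rhat r tau) N M := covered_ge brh htau N M.
    by move: (K / _) c1 c2 => k c1 c2 a b; split; rewrite /a /b; lra.
  apply/eqP; rewrite eq_le; apply/andP; split;
    by apply: (@le_of_inv_nat _ _ _ K) => N; have [] := close N.
have loc w bl br' : bl < 0 -> 0 <= br' -> local_at q (Ufam X w) eta0_three Q bl br'.
  by move=> h1 h2; apply: local_three => //; exact: lt_le_trans h2.
have loc' w bl br' : bl < 0 -> 0 <= br' -> local_at q (Ufam X' w) (eta0_two x) Q' bl br'.
  by move=> h1 h2; apply: local_two => //; exact: lt_le_trans h2.
apply: etrans (prE P (measurable_asep_event hX q tau br eta0_three Q)) _.
apply: esym; apply: etrans (prE P' (measurable_asep_event hX' q tau brh (eta0_two x) Q')) _.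
apply/esym; congr EFin.
apply: (@eq_of_geometric _ _ _ 4 (expR (- (C * tau)))).
- exact: expR_gt0.
- by rewrite -expR0 ler_expR oppr_le0 mulr_ge0.
- move=> n.
  have := asep_event_approx hX br htau loc n; have := asep_event_approx hX' brh htau loc' n.
  rewrite (eqM n.+1) !ler_norml => /andP[h1 h2] /andP[h3 h4].
  by apply/andP; split; lra.
Qed.
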